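(* Consider the $N$-player mixed-order game and the closed-loop system described in the context, under the following hypotheses. (A1) For each $i\in\mathbb{N}$, $f_i$ is $\mathcal{C}^2$ and $\nabla_i f_i$ is globally Lipschitz on $\mathbb{R}^N$ with constant $\bar l_i$. (A2) The communication graph $\mathcal{G}$ is undirected and connected. (A3) There is a constant $m>0$ such that $(\mathbf{x}-\mathbf{z})^T(\mathcal{P}(\mathbf{x})-\mathcal{P}(\mathbf{z}))\ge m\|\mathbf{x}-\mathbf{z}\|^2$ for all $\mathbf{x},\mathbf{z}\in\mathbb{R}^N$, where $\mathcal{P}(\mathbf{x})=[\nabla_1 f_1(\mathbf{x}),\dots,\nabla_N f_N(\mathbf{x})]^T$. (A4) For all $i\in\mathbb{N}_s$, $j\in\mathbb{N}$, $\nabla^2_{ij}f_i(\mathbf{x})$ is bounded for $\mathbf{x}\in\mathbb{R}^N$. (A5) For each $i\in\mathbb{N}$, $g_i$ is globally Lipschitz with constant $\eta_i$ and $d_i(t)$ is bounded. Assume moreover that $\delta\ge|\varepsilon_i|+|d_i(t)|$ and $W_i^{*T}W_i^*\le W_{\max}$ for all $i\in\mathbb{N}$ and $t\ge 0$. Then, for any pair of positive constants $\Lambda$ and $\Xi$, there exist positive constants $\beta^*$ and $k_2^*$ such that for each $\beta>\beta^*$ and $k_2>k_2^*$ there exist positive constants $k_1^*(k_2)$ and $k_3^*(k_2)$ such that for each $k_1>k_1^*(k_2)$ and $k_3>k_3^*(k_2)$ there exists a positive constant $k_4^*(k_2,k_3)$ such that for each $k_4>k_4^*(k_2,k_3)$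 the following holds: there is some $T\ge 0$ with $$\|\mathbf{x}(t)-\mathbf{x}^*\|\le\Xi\quad\text{for all } t>T,$$ given that $$\left\|\left[(\bar{\mathbf{x}}(0)-\mathbf{x}^* )^T,\ \mathbf{v}_s^T(0),\ (\mathbf{y}(0)-\mathbf{1}_N\otimes\bar{\mathbf{x}}(0))^T,\ (\mathbf{x}_f(0)-\mathbf{z}_f(0))^T\right]^T\right\|+\sum_{i=1}^N\tilde W_i(0)^T\tilde W_i(0)\le\Lambda .$$
   Context: **Game.** $\mathbb{N}=\{1,\dots,N\}$ is the set of players, $\mathbb{N}_f=\{1,\dots,n\}$ (first-order players), $\mathbb{N}_s=\{n+1,\dots,N\}$ (second-order players), $1\le n<N$. Player $i$ has action $x_i\in\mathbb{R}$ and cost $f_i(\mathbf{x})=f_i(x_i,\mathbf{x}_{-i})$, where $\mathbf{x}=[x_1,\dots,x_N]^T$ and $\mathbf{x}_{-i}$ collects the actions of all players other than $i$. Notation: $\nabla_i f_i=\partial f_i/\partial x_i$, $\nabla^2_{ij}f_i=\partial^2 f_i/\partial x_i\partial x_j$. $\mathbf{x}^*$ denotes the Nash equilibrium: $f_i(x_i^*,\mathbf{x}_{-i}^* )\le f_i(x_i,\mathbf{x}_{-i}^* )$ for all $x_i\in\mathbb{R}$, $i\in\mathbb{N}$. **Player dynamics.** For $i\in\mathbb{N}_f$: $\dot x_i=u_i+g_i(\mathbf{x})+d_i(t)$. For $i\in\mathbb{N}_s$: $\dot x_i=v_i$, $\dot v_i=u_i+g_i(\mathbf{x})+d_i(t)$.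 Here $u_i$ is the control, $g_i:\mathbb{R}^N\to\mathbb{R}$ the unknown dynamics, $d_i(t)\in\mathbb{R}$ the disturbance. **Graph.** $\mathcal{G}$ is a graph on $\mathbb{N}$ with adjacency entries $a_{ij}=1$ if $(j,i)$ is an edge, $a_{ij}=0$ otherwise, $a_{ii}=0$. **Neural network.** $S_i(\mathbf{y})=[s_{i1}(\mathbf{y}),\dots,s_{iq_i}(\mathbf{y})]^T$ is a vector of $q_i$ Gaussian functions $s_{ik}(\mathbf{y})=\exp[-(\mathbf{y}-\mu_{ik})^T(\mathbf{y}-\mu_{ik})/\rho_{ik}^2]$ with centers $\mu_{ik}\in\mathbb{R}^N$ and widths $\rho_{ik}$. $W_i^*\in\mathbb{R}^{q_i}$ is the ideal weight and $\varepsilon_i$ the approximation error: on a compact set containing the trajectory $\mathbf{y}_i(t)$, $t\ge0$, one has $g_i(\mathbf{y}_i)=W_i^{*T}S_i(\mathbf{y}_i)+\varepsilon_i$ with $|\varepsilon_i|\le\bar\varepsilon$ for a positive constant $\bar\varepsilon$. $\hat W_i\in\mathbb{R}^{q_i}$ is the adaptive weight and $\tilde W_i=\hat W_i-W_i^*$. **Controls.** $k_1,k_2,k_3,k_4,\beta,W_{\max},\delta,\epsilon$ are positive constants and $\mathcal{K}$ is the constant with $\mathcal{K}=e^{-(\mathcal{K}+1)}$. Put $e_i=x_i-z_i$ for $i\in\mathbb{N}_f$ and $e_i=\bar v_i:=k_2\nabla_i f_i(\mathbf{y}_i)+v_i$ for $i\in\mathbb{N}_s$, and $\phi_i=\delta\tanh(\mathcal{K}\delta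 e_i/\epsilon)$. Then - for $i\in\mathbb{N}_f$: $u_i=-k_1(x_i-z_i)-\hat W_i^TS_i(\mathbf{y}_i)-\phi_i$, with $z_i\in\mathbb{R}$, $\dot z_i=-k_2\nabla_i f_i(\mathbf{y}_i)$; - for $i\in\mathbb{N}_s$: $u_i=-k_2k_4\nabla_i f_i(\mathbf{y}_i)-k_4v_i-\hat W_i^TS_i(\mathbf{y}_i)-\phi_i$; - for all $i\in\mathbb{N}$: $\dot{\hat W}_i=\beta S_i(\mathbf{y}_i)e_i$ if $\hat W_i^T\hat W_i<W_{\max}$, or if $\hat W_i^T\hat W_i=W_{\max}$ and $e_i\hat W_i^TS_i(\mathbf{y}_i)<0$; and $\dot{\hat W}_i=\beta S_i(\mathbf{y}_i)e_i-\beta\frac{e_i\hat W_i^TS_i(\mathbf{y}_i)}{\hat W_i^T\hat W_i}\hat W_i$ if $\hat W_i^T\hat W_i=W_{\max}$ and $e_i\hat W_i^TS_i(\mathbf{y}_i)\ge0$; initial values satisfy $\hat W_i(0)^T\hat W_i(0)\le W_{\max}$; - $\mathbf{y}_i=[y_{i1},\dots,y_{iN}]^T$ with $\dot y_{ij}=-k_3\left(\sum_{k=1}^N a_{ik}(y_{ij}-y_{kj})+a_{ij}(y_{ij}-\bar x_j)\right)$ for $i,j\in\mathbb{N}$, where $\bar x_j=z_j$ for $j\in\mathbb{N}_f$ and $\bar x_j=x_j$ for $j\in\mathbb{N}_s$. The closed-loop system is the player dynamics with these controls and update laws. $\nabla_i f_i(\mathbf{y}_i)$ means $\nabla_i f_i(\mathbf{x})|_{\mathbf{x}=\mathbf{y}_i}$.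 **Stacked vectors.** $\mathbf{x}_f=[x_1,\dots,x_n]^T$, $\mathbf{z}_f=[z_1,\dots,z_n]^T$, $\mathbf{v}_s=[v_{n+1},\dots,v_N]^T$, $\bar{\mathbf{x}}=[\bar x_1,\dots,\bar x_N]^T$, $\mathbf{y}=[\mathbf{y}_1^T,\dots,\mathbf{y}_N^T]^T$; $\mathbf{1}_N$ is the all-ones vector and $\otimes$ the Kronecker product. *)

(* Defs.v *)
From HB Require Import structures.
From mathcomp Require Import all_boot all_order all_algebra.
From mathcomp Require Import all_classical all_reals all_analysis.
Set Implicit Arguments.
Unset Strict Implicit.
Unset Printing Implicit Defensive.
Import Order.TTheory GRing.Theory Num.Theory.
Import numFieldNormedType.Exports.
Local Open Scope classical_set_scope.
Local Open Scope ring_scope.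

Section Euclidean.
Context {R : realType}.

Definition dotv {p : nat} (u v : 'rV[R]_p) : R := \sum_(k < p) u 0 k * v 0 k.

(* The library norm on 'rV[R]_p is the sup norm. *)
Definition enorm {p : nat} (u : 'rV[R]_p) : R := Num.sqrt (dotv u u).

Definition elipschitz {p : nat} (l : R) (h : 'rV[R]_p -> R) : Prop :=
  forall u v, `|h u - h v| <= l * enorm (u - v).

Definition partial {p : nat} (i : 'I_p) (h : 'rV[R]_p -> R) : 'rV[R]_p -> R :=
  fun u => 'D_(delta_mx 0 i) (h : 'rV[R]_p -> R^o) u.

Definition has_partial {p : nat} (i : 'I_p) (h : 'rV[R]_p -> R) : Prop :=
  forall u, derivable (h : 'rV[R]_p -> R^o) u (delta_mx 0 i).

Definition C1 {p : nat} (h : 'rV[R]_p -> R) : Prop :=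
  continuous h /\ forall i, has_partial i h /\ continuous (partial i h).

Definition C2 {p : nat} (h : 'rV[R]_p -> R) : Prop :=
  C1 h /\ forall i, C1 (partial i h).

Definition tanh (r : R) : R := (expR r - expR (- r)) / (expR r + expR (- r)).

(* s' = F on [0, +oo[ in the sense of Caratheodory: s is locally absolutely
   continuous and its derivative is F almost everywhere.  When F is continuous
   this is the classical notion; the weaker sense is needed because the weight
   update law is discontinuous in the state and the disturbances are only
   assumed to be bounded. *)
Definition caratheodory (s F : R -> R) : Prop :=
  forall t, 0 <= t ->
    lebesgue_measure.-integrable `[0, t] (EFin \o F) /\
    s t = s 0 + \int[lebesgue_measure]_(r in `[0, t]) F r.

End Euclidean.

(* The n + m players are indexed from 0: lshift m k, for k : 'I_n, are the
   first-order players and rshift n k, for k : 'I_m, the second-order ones. *)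
Record plant (R : realType) (n m : nat) := Plant {
  cost : 'I_(n + m) -> 'rV[R]_(n + m) -> R;
  drift : 'I_(n + m) -> 'rV[R]_(n + m) -> R;
  disturbance : 'I_(n + m) -> R -> R;
  edge : rel 'I_(n + m) (* edge j i : i receives information from j *)
}.

(* nn_size i is q_i, center and width are mu_ik and rho_ik. *)
Record network (R : realType) (N : nat) := Network {
  nn_size : 'I_N -> nat;
  center : forall i, 'I_(nn_size i) -> 'rV[R]_N;
  width : forall i, 'I_(nn_size i) -> R
}.

Record params (R : realType) := Params {
  k1 : R; k2 : R; k3 : R; k4 : R; beta : R;
  Wmax : R; delta : R; epsilon : R; kappa : R
}.

(* Row i of st_y is the estimate y_i held by player i. *)
Record state (R : realType) (n m : nat) (nn : network R (n + m)) := State {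
  st_x : 'rV[R]_(n + m);
  st_z : 'rV[R]_n;
  st_v : 'rV[R]_m;
  st_W : forall i : 'I_(n + m), 'rV[R]_(nn_size nn i);
  st_y : 'M[R]_(n + m)
}.

Section Game.
Context {R : realType} {n m : nat}.
Variable P : plant R n m.
Local Notation N := (n + m)%N.

Definition grad (i : 'I_N) : 'rV[R]_N -> R := partial i (cost P i).

(* d^2 f_i / dx_i dx_j *)
Definition hess (i j : 'I_N) : 'rV[R]_N -> R := partial i (partial j (cost P i)).

Definition pseudo_gradient (x : 'rV[R]_N) : 'rV[R]_N := \row_i grad i x.

Definition nash_equilibrium (xs : 'rV[R]_N) : Prop :=
  forall (i : 'I_N) (a : R),
    cost P i xs <= cost P i (\row_j (if j == i then a else xs 0 j)).

Definition adj (i j : 'I_N) : R := (edge P j i)%:R.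

Definition undirected_connected : Prop :=
  [/\ irreflexive (edge P), symmetric (edge P) & forall i j, connect (edge P) i j].

End Game.

Definition basis {R : realType} {N : nat} (nn : network R N) (i : 'I_N)
    (y : 'rV[R]_N) : 'rV[R]_(nn_size nn i) :=
  \row_k expR (- dotv (y - center k) (y - center k) / (width k) ^+ 2).

Section ClosedLoop.
Context {R : realType} {n m : nat}.
Variables (P : plant R n m) (nn : network R (n + m)) (c : params R).
Local Notation N := (n + m)%N.
Implicit Type s : state nn.

Definition est s (i : 'I_N) : 'rV[R]_N := row i (st_y s).

Definition xbar s : 'rV[R]_N := row_mx (st_z s) (rsubmx (st_x s)).

Definition err s : 'rV[R]_N :=
  row_mx (lsubmx (st_x s) - st_z s)
         (\row_k (k2 c * grad P (rshift n k) (est s (rshift n k)) + st_v s 0 k)).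

Definition phi s (i : 'I_N) : R :=
  delta c * tanh (kappa c * delta c * err s 0 i / epsilon c).

Definition nn_output s (i : 'I_N) : R := dotv (st_W s i) (basis nn i (est s i)).

Definition control_fst s (k : 'I_n) : R :=
  let i := lshift m k in
  - k1 c * (st_x s 0 i - st_z s 0 k) - nn_output s i - phi s i.

Definition control_snd s (k : 'I_m) : R :=
  let i := rshift n k in
  - k2 c * k4 c * grad P i (est s i) - k4 c * st_v s 0 k
    - nn_output s i - phi s i.

(* The law is specified only on the ball dotv W W <= Wmax; outside of it the
   last branch applies, which keeps dotv W W constant there, so that weights
   starting in the ball never leave it. *)
Definition weight_law s (i : 'I_N) : 'rV[R]_(nn_size nn i) :=
  let W := st_W s i in
  let S := basis nn i (est s i) in
  let e := err s 0 i in
  if (dotv W W < Wmax c) || ((dotv W W == Wmax c) && (e * dotv W S < 0))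
  then (beta c * e) *: S
  else (beta c * e) *: S - (beta c * (e * dotv W S / dotv W W)) *: W.

Definition estimator_law s (i j : 'I_N) : R :=
  - k3 c * (\sum_(k < N) adj P i k * (st_y s i j - st_y s k j)
            + adj P i j * (st_y s i j - xbar s 0 j)).

Record closed_loop_solution (s : R -> state nn) : Prop := ClosedLoopSolution {
  x_fst_dyn : forall k : 'I_n, let i := lshift m k in
    caratheodory (fun t => st_x (s t) 0 i)
      (fun t => control_fst (s t) k + drift P i (st_x (s t)) + disturbance P i t);
  x_snd_dyn : forall k : 'I_m,
    caratheodory (fun t => st_x (s t) 0 (rshift n k)) (fun t => st_v (s t) 0 k);
  v_dyn : forall k : 'I_m, let i := rshift n k in
    caratheodory (fun t => st_v (s t) 0 k)
      (fun t => control_snd (s t) k + drift P i (st_x (s t)) + disturbance P i t);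
  z_dyn : forall k : 'I_n, let i := lshift m k in
    caratheodory (fun t => st_z (s t) 0 k)
      (fun t => - k2 c * grad P i (est (s t) i));
  W_dyn : forall (i : 'I_N) (l : 'I_(nn_size nn i)),
    caratheodory (fun t => st_W (s t) i 0 l) (fun t => weight_law (s t) i 0 l);
  y_dyn : forall i j : 'I_N,
    caratheodory (fun t => st_y (s t) i j) (fun t => estimator_law (s t) i j);
  W_init : forall i : 'I_N, dotv (st_W (s 0) i) (st_W (s 0) i) <= Wmax c
}.

(* Ws is the ideal weight and eps the approximation error of player i, with
   bound epsbar, on a compact set containing the trajectory of its estimate. *)
Definition approximates (s : R -> state nn) (i : 'I_N)
    (Ws : 'rV[R]_(nn_size nn i)) (eps : 'rV[R]_N -> R) (epsbar : R) : Prop :=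
  exists Omega : set 'rV[R]_N,
    [/\ compact Omega,
        forall t, 0 <= t -> Omega (est (s t) i) &
        forall y, Omega y ->
          drift P i y = dotv Ws (basis nn i y) + eps y /\ `|eps y| <= epsbar].

(* mxvec stacks the rows y_i - xbar, i.e. it yields y - 1_N (x) xbar. *)
Definition init_deviation (xs : 'rV[R]_N) s : R :=
  enorm (row_mx (xbar s - xs)
        (row_mx (st_v s)
        (row_mx (mxvec (\matrix_(i, j) (st_y s i j - xbar s 0 j)))
                (lsubmx (st_x s) - st_z s)))).

End ClosedLoop.

(* Main.v *)
Require Import Defs.
From HB Require Import structures.
From mathcomp Require Import all_boot all_order all_algebra.
From mathcomp Require Import all_classical all_reals all_analysis.
From mathcomp Require Import ring lra.
Set Implicit Arguments.
Unset Strict Implicit.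
Unset Printing Implicit Defensive.
Import Order.TTheory GRing.Theory Num.Theory.
Import numFieldNormedType.Exports.
Local Open Scope classical_set_scope.
Local Open Scope ring_scope.

(** Why the theorem holds.

    The Lyapunov function is
      V = (|xbar - xs|^2 + |Y|^2 + |e_f|^2 + |e_s|^2) / 2
          + sum_i |W_i - Ws_i|^2 / (2 beta),
    where Y_ij = y_ij - xbar_j is the disagreement of the estimates and e_f, e_s
    are the parts of the error vector that belong to the first-order and the
    second-order players.  Write x, y, f, g for the four norms in the first term.

    The weight law is built so that the contribution of W_i - Ws_i to V' is at
    most e_i (W_i - Ws_i) . S_i (adaptation_rate), which is exactly what the
    feedback through e_i subtracts; the smooth robust term delta tanh(...)
    dominates approximation error and disturbance up to epsilon per player
    (tanh_gap, compensation_rate).  What remains of V' is a quadratic form in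
    x, y, f, g with diagonal - k2 mconst x^2 (strong monotonicity, tracking_rate),
    - (k3 / C) y^2 (connectedness, pinned_form_coercive and consensus_rate),
    - k1 f^2 and - k4 g^2, plus N epsilon.  The gains in the cross terms are k2
    and, in the single product g y, k2 k3: the reference k2 grad_i f_i (y_i) of a
    second-order player moves as fast as its estimates.  Hence k1 and k3 can be
    chosen large with respect to k2, then k4 with respect to k2 and k3, and
      V' <= - 4 mu (x^2 + y^2 + f^2 + g^2) + N epsilon,   mu = k2 mconst / 8
    (cross_terms_le, lyapunov_rate_decay).

    There is no decay in the weight errors, but the weight law keeps every W_i
    in its ball (weights_in_ball), so their share of V is at most
    2 N Wmax / beta.  With beta large against Wmax / Xi^2, and k2 large
    against epsilon / Xi^2, V decreases at the fixed rate mu Xi^2 as long as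
    V > Xi^2 / 4 (lyapunov_rate_outside).  Since |x - xs|^2 <= 4 V
    (action_error_le) and V (0) is bounded in terms of Lambda and the gains
    (lyapunov_init), the time T depends on these data only.

    Solutions satisfy their equations almost everywhere only, so V' is used in
    integrated form: [subcaratheodory V G] says that V grows between two times by
    at most the integral of G.  The terms of V are squares, and
    subcaratheodory_half_sqr is the chain rule for them.  It accepts a summand
    of which only a bound on the increments is known; that is how
    k2 grad_i f_i (y_i) enters e_s, through the Lipschitz constant of the
    gradient. *)

(** * Integral inequalities along absolutely continuous functions *)

Section Increments.
Context {R : realType}.
Local Notation mu := (@lebesgue_measure R).
Implicit Types (f g F G V e h q v p : R -> R) (a b c t : R).

Definition segment_integrable F : Prop :=
  forall t, 0 <= t -> mu.-integrable `[0, t] (EFin \o F).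

Definition iint a b F : R := \int[mu]_(r in `[a, b]) F r.

(** The one-sided analogue of [caratheodory]: f' <= F in integrated form.  Unlike
    an almost everywhere differential inequality it rules out upward jumps. *)
Definition subcaratheodory f F : Prop :=
  segment_integrable F /\ forall a b, 0 <= a -> a <= b -> f b - f a <= iint a b F.

Lemma integrable_itv F a b : segment_integrable F -> 0 <= a ->
  mu.-integrable `[a, b] (EFin \o F).
Proof.
move=> iF a0; apply: (integrableS _ _ _ (iF `|b| (normr_ge0 b))) => //.
move=> r /=; rewrite !in_itv/= => /andP[ar rb].
by rewrite (le_trans a0 ar) (le_trans rb)// ler_norm.
Qed.

Lemma segment_integrable_cst c : segment_integrable (fun=> c).
Proof.
move=> t t0; apply/integrableP; split; first exact: measurable_cst.
under eq_integral do rewrite /=.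
rewrite integral_cst//= lebesgue_measure_itv/= lte_fin.
by case: ifPn => _; rewrite ?mule0 ?ltry// -EFinB -EFinM ltry.
Qed.

Lemma segment_integrableD F G : segment_integrable F -> segment_integrable G ->
  segment_integrable (fun t => F t + G t).
Proof.
move=> iF iG t t0; have := integrableD _ (iF t t0) (iG t t0).
exact.
Qed.

Lemma segment_integrableN F : segment_integrable F ->
  segment_integrable (fun t => - F t).
Proof. by move=> iF t t0; have := integrableN (iF t t0); exact. Qed.

Lemma segment_integrableZ c F : segment_integrable F ->
  segment_integrable (fun t => c * F t).
Proof.
move=> iF t t0; have := integrableZl _ c (iF t t0); exact.
Qed.

Lemma segment_integrable_norm F : segment_integrable F ->
  segment_integrable (fun t => `|F t|).
Proof. by move=> iF t t0; exact: integrable_norm (iF t t0). Qed.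

Lemma segment_integrable_sum (I : Type) (s : seq I) (F : I -> R -> R) :
  (forall i, segment_integrable (F i)) ->
  segment_integrable (fun t => \sum_(i <- s) F i t).
Proof.
move=> iF; elim: s => [|i s ih].
  by under eq_fun do rewrite big_nil; exact: segment_integrable_cst.
by under eq_fun do rewrite big_cons; exact: segment_integrableD.
Qed.

Lemma iint_cat F a b c : segment_integrable F -> 0 <= a -> a <= b -> b <= c ->
  iint a c F = iint a b F + iint b c F.
Proof.
move=> iF a0 ab bc.
have /(_ b) := @Rintegral_itvB R F (BLeft a) (BRight c) _ (integrable_itv c iF a0).
rewrite !bnd_simp => /(_ ab bc).
rewrite Rintegral_itv_obnd_cbnd; last first.
  apply: (integrableS _ _ _ (integrable_itv c iF a0)) => //.
  by apply: subset_itvr; rewrite bnd_simp.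
by rewrite -!/(iint _ _ _) => <-; rewrite addrCA subrr addr0.
Qed.

Lemma le_iint F G a b : segment_integrable F -> segment_integrable G -> 0 <= a ->
  (forall r, a <= r -> r <= b -> F r <= G r) -> iint a b F <= iint a b G.
Proof.
move=> iF iG a0 FG; apply: le_Rintegral => //; try exact: integrable_itv.
by move=> r /=; rewrite in_itv/= => /andP[]; exact: FG.
Qed.

Lemma iintD F G a b : segment_integrable F -> segment_integrable G -> 0 <= a ->
  iint a b (fun r => F r + G r) = iint a b F + iint a b G.
Proof. by move=> iF iG a0; apply: RintegralD => //; exact: integrable_itv. Qed.

Lemma iintZ c F a b : segment_integrable F -> 0 <= a ->
  iint a b (fun r => c * F r) = c * iint a b F.
Proof. by move=> iF a0; apply: RintegralZl => //; exact: integrable_itv. Qed.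

Lemma iintN F a b : segment_integrable F -> 0 <= a ->
  iint a b (fun r => - F r) = - iint a b F.
Proof.
move=> iF a0; rewrite -mulN1r -iintZ//; congr Rintegral.
by apply/funext => r; rewrite mulN1r.
Qed.

Lemma iint_cst c a b : a <= b -> iint a b (fun=> c) = c * (b - a).
Proof.
move=> ab; rewrite /iint Rintegral_cst//= lebesgue_measure_itv/= lte_fin.
by move: ab; rewrite le_eqVlt => /predU1P[->|->//]; rewrite ltxx subrr.
Qed.

Lemma iint_sum (I : Type) (s : seq I) (F : I -> R -> R) a b :
  (forall i, segment_integrable (F i)) -> 0 <= a -> a <= b ->
  iint a b (fun r => \sum_(i <- s) F i r) = \sum_(i <- s) iint a b (F i).
Proof.
move=> iF a0 ab; elim: s => [|i s ih].
  rewrite big_nil -[RHS](mul0r (b - a)) -iint_cst//.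
  by congr Rintegral; apply/funext => r; rewrite big_nil.
rewrite big_cons -ih -iintD//; last exact: segment_integrable_sum.
by congr Rintegral; apply/funext => r; rewrite big_cons.
Qed.

Lemma iint_ge0 F a b : (forall r, 0 <= F r) -> 0 <= iint a b F.
Proof. by move=> F0; apply: Rintegral_ge0. Qed.

Lemma ler_norm_iint F a b : segment_integrable F -> 0 <= a ->
  `|iint a b F| <= iint a b (fun r => `|F r|).
Proof. by move=> iF a0; apply: le_normr_Rintegral => //; exact: integrable_itv. Qed.

(** Absolute continuity of the integral, uniformly over the intervals of [0, T];
    it provides every smallness argument on short time intervals below. *)
Lemma iint_small F T eps : segment_integrable F -> 0 < eps ->
  exists2 d, 0 < d & forall a b, 0 <= a -> a <= b -> b <= T -> b - a < d ->
    iint a b (fun r => `|F r|) < eps.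
Proof.
move=> iF eps0.
have iT : mu.-integrable setT (EFin \o (F \_ `[0, `|T|])).
  rewrite -restrict_EFin; apply/integrable_restrict => //=.
  by rewrite setTI; apply: iF.
have [d [d0 dP]] := integral_normr_continuous iT eps0.
exists d => // a b a0 ab bT bad.
have <- : \int[mu]_(r in `[a, b]) `|(F \_ `[0, `|T|]) r| = iint a b (fun r => `|F r|).
  apply: eq_Rintegral => r; rewrite inE/= in_itv/= => /andP[ar rb].
  rewrite patchE mem_set//= in_itv/= (le_trans a0 ar)/=.
  by rewrite (le_trans rb)// (le_trans bT)// ler_norm.
apply: dP => //; rewrite [ltLHS](lebesgue_measure_itv `[a, b])/= lte_fin.
by case: ifPn => _; rewrite ?lte_fin// -EFinB lte_fin.
Qed.

Lemma caratheodory_iint f F a b : caratheodory f F -> 0 <= a -> a <= b ->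
  f b - f a = iint a b F.
Proof.
move=> cF a0 ab.
have iF : segment_integrable F by move=> t /cF[].
have [_ ->] := cF b (le_trans a0 ab); have [_ ->] := cF a a0.
rewrite -!/(iint _ _ _) (iint_cat iF _ a0 ab)//.
by rewrite opprD addrACA subrr add0r addrAC subrr add0r.
Qed.

Lemma caratheodory_cst c : caratheodory (fun=> c) (fun=> 0).
Proof.
move=> t t0; split; first exact: segment_integrable_cst.
by rewrite -/(iint _ _ _) iint_cst// mul0r addr0.
Qed.

Lemma caratheodoryB f g F G : caratheodory f F -> caratheodory g G ->
  caratheodory (fun t => f t - g t) (fun t => F t - G t).
Proof.
move=> cf cg.
have iF : segment_integrable F by move=> t /cf[].
have iG : segment_integrable G by move=> t /cg[].
move=> t t0; split; first exact: (segment_integrableD iF (segment_integrableN iG)).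
rewrite -/(iint _ _ _) iintD//; last exact: segment_integrableN.
have := caratheodory_iint cf (lexx 0) t0; have := caratheodory_iint cg (lexx 0) t0.
by rewrite iintN// => <- <-; ring.
Qed.

Lemma dominated_continuous e h T : segment_integrable h ->
  (forall a b, 0 <= a -> a <= b -> `|e b - e a| <= iint a b h) ->
  {within `[0, T], continuous e}.
Proof.
move=> ih eh; apply/subspace_continuousP => /= t; rewrite in_itv/= => /andP[t0 tT].
apply/cvgrPdist_lt => /= eps eps0.
have [d d0 dP] := iint_small T ih eps0.
rewrite near_withinE; near=> r => /=; rewrite in_itv/= => /andP[r0 rT].
have rtd : `|r - t| < d.
  by rewrite distrC; near: r; exists d => //=.
have small a b : 0 <= a -> a <= b -> b <= T -> b - a < d -> `|e b - e a| < eps.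
  move=> a0 ab bT bad; apply: le_lt_trans (eh _ _ a0 ab) _.
  apply: le_lt_trans (dP _ _ a0 ab bT bad).
  apply: le_iint => //; first exact: segment_integrable_norm.
  by move=> *; exact: ler_norm.
have [rt|/ltW tr] := leP r t.
  by apply: small => //; rewrite (le_lt_trans _ rtd)// distrC ler_norm.
by rewrite distrC; apply: small => //; rewrite (le_lt_trans _ rtd)// ler_norm.
Unshelve. all: by end_near. Qed.

(** A function with dominated increments is continuous and bounded on compact
    intervals, which is what makes the product integrable. *)
Lemma dominated_mul_integrable e h F : segment_integrable h ->
  (forall a b, 0 <= a -> a <= b -> `|e b - e a| <= iint a b h) ->
  segment_integrable F -> segment_integrable (fun t => e t * F t).
Proof.
move=> ih eh iF t t0.
have := @integrableMr _ _ _ mu `[0, t] (measurable_itv _) e (EFin \o F).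
apply; last exact: iF.
- apply: measurable_realfun.subspace_continuous_measurable_fun => //.
  exact: dominated_continuous ih eh.
- exists (`|e 0| + iint 0 t (fun r => `|h r|)); split; first by rewrite num_real.
  move=> M ltM r /=; rewrite in_itv/= => /andP[r0 rt].
  rewrite (le_trans _ (ltW ltM))// -lerBlDl.
  apply: le_trans (lerB_dist _ _) _.
  apply: le_trans (eh _ _ (lexx 0) r0) _.
  have inh := segment_integrable_norm ih.
  rewrite (iint_cat inh _ r0 rt)// ler_wpDr ?iint_ge0//.
  by apply: le_iint => // *; exact: ler_norm.
Qed.

(** A relation that composes along adjacent intervals holds on [a, b] once it
    holds on all short intervals: cut [a, b] into pieces of length d / 2. *)
Lemma chain_small (Q : R -> R -> Prop) a b d : 0 < d -> a <= b ->
  (forall r s t, a <= r -> r <= s -> s <= t -> t <= b -> Q r s -> Q s t -> Q r t) ->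
  (forall r s, a <= r -> r <= s -> s <= b -> s - r < d -> Q r s) -> Q a b.
Proof.
move=> d0 ab trQ smallQ.
have d20 : 0 < d / 2 by rewrite divr_gt0.
suff step k : forall t, a <= t -> t <= b -> t - a <= k%:R * (d / 2) -> Q a t.
  apply: (step (Num.truncn ((b - a) / (d / 2))).+1) => //.
  by rewrite -ler_pdivrMr// ltW// truncnS_gt.
elim: k => [|k ih] t at_ tb.
  by rewrite mul0r => ta; apply: smallQ => //; rewrite (le_lt_trans ta).
have [tad|tad] := ltP (t - a) d; first by move=> _; exact: smallQ.
move=> tk; have art : a <= t - d / 2 by move: tad d0; lra.
have rt : t - d / 2 <= t by move: d20; lra.
apply: (trQ _ (t - d / 2)) => //.
- apply: ih => //; first exact: le_trans tb.
  by move: tk; rewrite -natr1 mulrDl mul1r; lra.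
- by apply: smallQ => //; move: d0; lra.
Qed.

(** The chain rule for a square, for e = q + v with v absolutely continuous and q
    known only through a bound p on the speed of its increments.  On a short
    interval the increment of e^2 / 2 is the mean of the end values of e times the
    increment of e, and that mean differs from e by at most w inside the
    interval.  The resulting error is w times an additive quantity, so it does
    not accumulate when short intervals are chained. *)
Lemma subcaratheodory_half_sqr q v F p :
  caratheodory v F -> segment_integrable p -> (forall t, 0 <= p t) ->
  (forall a b, 0 <= a -> a <= b -> `|q b - q a| <= iint a b p) ->
  subcaratheodory (fun t => (q t + v t) ^+ 2 / 2)
                  (fun t => (q t + v t) * F t + `|q t + v t| * p t).
Proof.
move=> cv ip p0 qp; pose e t := q t + v t.
have iF : segment_integrable F by move=> t /cv[].
have inF := segment_integrable_norm iF.
pose h t := `|F t| + p t.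
have ih : segment_integrable h by exact: segment_integrableD.
have h0 t : 0 <= h t by rewrite addr_ge0.
have eh a b : 0 <= a -> a <= b -> `|e b - e a| <= iint a b h.
  move=> a0 ab; rewrite iintD//.
  rewrite (_ : e b - e a = (v b - v a) + (q b - q a)); last by rewrite /e; ring.
  apply: le_trans (ler_normD _ _) (lerD _ _); last exact: qp.
  by rewrite (caratheodory_iint cv)//; exact: ler_norm_iint.
have neh a b : 0 <= a -> a <= b -> `| `|e b| - `|e a| | <= iint a b h.
  by move=> a0 ab; apply: le_trans (ler_dist_dist _ _) (eh _ _ a0 ab).
have ieF : segment_integrable (fun t => e t * F t).
  exact: dominated_mul_integrable ih eh iF.
have inep : segment_integrable (fun t => `|e t| * p t).
  exact: dominated_mul_integrable ih neh ip.
have iG := segment_integrableD ieF inep.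
split=> // a b a0 ab; rewrite -/(e a) -/(e b).
set G := (fun t => e t * F t + `|e t| * p t).
apply/ler_addgt0Pr => eps eps0.
(* The total error w * iint a b h of the chained estimates is at most eps. *)
pose w := eps / (1 + iint a b h).
have H1 : 0 < 1 + iint a b h by rewrite ltr_wpDr ?iint_ge0.
have w0 : 0 < w by rewrite divr_gt0.
suff : e b ^+ 2 / 2 - e a ^+ 2 / 2 <= iint a b G + w * iint a b h.
  move=> /le_trans; apply; rewrite lerD2l /w mulrAC ler_pdivrMr//.
  by rewrite ler_pM2l// lerDr.
have [d d0 dP] := iint_small b ih w0.
pose Q r s := e s ^+ 2 / 2 - e r ^+ 2 / 2 <= iint r s G + w * iint r s h.
apply: (@chain_small Q a b d) => //.
  move=> r s t ar rs st tb; have r0 := le_trans a0 ar.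
  by rewrite /Q (iint_cat iG _ rs st)// (iint_cat ih _ rs st)//; lra.
move=> r s ar rs sb srd; rewrite /Q; have r0 := le_trans a0 ar.
have hw u : r <= u -> u <= s -> `|(e s + e r) / 2 - e u| <= w.
  move=> ru us; have u0 := le_trans r0 ru.
  have -> : (e s + e r) / 2 - e u = ((e s - e u) - (e u - e r)) / 2 by field.
  rewrite normrM (@ger0_norm _ 2^-1)// ler_pdivrMr//.
  have hsr : iint r s h < w.
    have -> : h = fun t => `|h t| by apply/funext => t; rewrite ger0_norm.
    exact: dP.
  apply: le_trans (ler_normB _ _) _.
  apply: le_trans (lerD (eh _ _ u0 us) (eh _ _ r0 ru)) _.
  rewrite addrC -(iint_cat ih)//; move: hsr w0; lra.
have -> : e s ^+ 2 / 2 - e r ^+ 2 / 2 =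
  (e s + e r) / 2 * (v s - v r) + (e s + e r) / 2 * (q s - q r).
  by rewrite /e; field.
rewrite (caratheodory_iint cv r0 rs).
have : (e s + e r) / 2 * (q s - q r) <= `|(e s + e r) / 2| * iint r s p.
  apply: le_trans (ler_norm _) _; rewrite normrM ler_wpM2l//; exact: qp.
move=> /(lerD (lexx _)) /le_trans; apply.
rewrite -!iintZ// -!iintD//; try exact: segment_integrableZ.
apply: le_iint => //.
- by apply: segment_integrableD; exact: segment_integrableZ.
- by apply: segment_integrableD => //; exact: segment_integrableZ.
move=> u ru us; rewrite /G/h.
have hwu := hw u ru us.
have nwu : `|(e s + e r) / 2| - `|e u| <= w.
  by apply: le_trans hwu; exact: lerB_dist.
have h1 : ((e s + e r) / 2 - e u) * F u <= w * `|F u|.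
  by apply: le_trans (ler_norm _) _; rewrite normrM ler_wpM2r.
have h2 : (`|(e s + e r) / 2| - `|e u|) * p u <= w * p u by rewrite ler_wpM2r.
by move: h1 h2; rewrite !mulrBl; lra.
Qed.

Lemma subcaratheodory_half_sqr0 v F : caratheodory v F ->
  subcaratheodory (fun t => v t ^+ 2 / 2) (fun t => v t * F t).
Proof.
move=> cv.
have := @subcaratheodory_half_sqr (fun=> 0) v F (fun=> 0) cv
  (segment_integrable_cst 0) (fun=> lexx 0).
have -> : (fun t => (0 + v t) ^+ 2 / 2) = (fun t => v t ^+ 2 / 2).
  by apply/funext => t; rewrite add0r.
have -> : (fun t => (0 + v t) * F t + `|0 + v t| * 0) = (fun t => v t * F t).
  by apply/funext => t; rewrite add0r mulr0 addr0.
by apply => a b _ ab; rewrite subrr normr0 iint_cst// mul0r.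
Qed.

Lemma subcaratheodoryD f g F G : subcaratheodory f F -> subcaratheodory g G ->
  subcaratheodory (fun t => f t + g t) (fun t => F t + G t).
Proof.
move=> [iF fF] [iG gG]; split; first exact: segment_integrableD.
move=> a b a0 ab; rewrite iintD//.
by have := fF a b a0 ab; have := gG a b a0 ab; lra.
Qed.

Lemma subcaratheodory_sum (I : Type) (s : seq I) (f F : I -> R -> R) :
  (forall i, subcaratheodory (f i) (F i)) ->
  subcaratheodory (fun t => \sum_(i <- s) f i t) (fun t => \sum_(i <- s) F i t).
Proof.
move=> fF; elim: s => [|i s ih].
  rewrite (_ : (fun=> _) = fun=> 0); last by apply/funext => t; rewrite big_nil.
  rewrite (_ : (fun=> \sum_(_ <- _) _) = fun=> 0); last first.
    by apply/funext => t; rewrite big_nil.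
  split; first exact: segment_integrable_cst.
  by move=> a b _ ab; rewrite iint_cst// mul0r subrr.
under eq_fun do rewrite big_cons; under [X in _ X]eq_fun do rewrite big_cons.
exact: subcaratheodoryD.
Qed.

Lemma subcaratheodoryZ c f F : 0 <= c -> subcaratheodory f F ->
  subcaratheodory (fun t => c * f t) (fun t => c * F t).
Proof.
move=> c0 [iF fF]; split; first exact: segment_integrableZ.
by move=> a b a0 ab; rewrite iintZ// -mulrBr ler_wpM2l// fF.
Qed.

(** A quantity that decreases at rate k0 above the level K stays below
    max (K, M - k0 t).  If the bound failed at time t, it would fail on an
    interval after the last time t1 at which it held; there V decreases at least
    as fast as the bound.  V may be discontinuous, so the comparison starts from
    times r slightly before t1 at which the bound does hold. *)
Lemma subcaratheodory_decay V G K M k0 t : subcaratheodory V G -> 0 <= k0 ->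
  V 0 <= M -> (forall t, 0 <= t -> K < V t -> G t <= - k0) ->
  0 <= t -> V t <= Num.max K (M - k0 * t).
Proof.
move=> [iG VG] k00 V0M decG t0; rewrite leNgt; apply/negP => ltV.
pose b r := Num.max K (M - k0 * r).
pose S := [set r | 0 <= r <= t /\ V r <= b r].
have S0 : S 0 by split; rewrite ?lexx ?t0// /b mulr0 subr0 le_max V0M orbT.
have ubS : ubound S t by move=> r [/andP[]].
have supS : has_sup S by split; [exists 0 | exists t].
set t1 := sup S.
have t1t : t1 <= t by apply: ge_sup => //; exists 0.
have t10 : 0 <= t1 by apply: ub_le_sup => //; exists t.
have above r : t1 < r -> r <= t -> b r < V r.
  move=> t1r rt; rewrite ltNge; apply/negP => Vr.
  have : r <= t1.
    apply: ub_le_sup; first by exists t.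
    by split=> //; rewrite rt (le_trans t10 (ltW t1r)).
  by rewrite leNgt t1r.
have b_drop r s : r <= s -> b r - k0 * (s - r) <= b s.
  move=> rs; rewrite /b lerBlDr ge_max; apply/andP; split.
    by rewrite ler_wpDr ?mulr_ge0 ?subr_ge0// le_max lexx.
  rewrite -lerBlDr le_max; apply/orP; right; lra.
have [eps eps0 epsP] : exists2 eps, 0 < eps & V t = b t + 2 * eps.
  exists ((V t - b t) / 2); last by field.
  by rewrite divr_gt0// subr_gt0.
have [d0 d00 d0P] := iint_small t iG eps0.
(* Between r and s both the integral of G and the drop of b are below eps. *)
pose d := Num.min d0 (eps / (k0 + 1)).
have k1 : 0 < k0 + 1 by lra.
have d_gt0 : 0 < d by rewrite lt_min d00 divr_gt0.
have k0d : k0 * d <= eps.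
  have : d <= eps / (k0 + 1) by rewrite ge_min lexx orbT.
  rewrite ler_pdivlMr// mulrDr mulr1 => dle; apply: le_trans dle.
  by rewrite mulrC ler_wpDr// ltW.
have d20 : 0 < d / 2 by rewrite divr_gt0.
have [r [/andP[r0 rt] Vr] t1r] := sup_adherent d20 supS.
rewrite -/t1 in t1r.
have rt1 : r <= t1.
  by apply: ub_le_sup; [exists t | split=> //; rewrite r0].
(* s lies beyond t1, so that the decay hypothesis applies on all of [s, t], which
   is a single point when t1 = t. *)
pose s := Num.min t (t1 + d / 2).
have st : s <= t by rewrite ge_min lexx.
have t1s : t1 <= s by rewrite le_min t1t lerDl ltW.
have rs := le_trans rt1 t1s; have s0 := le_trans r0 rs.
have srd : s - r < d.
  have : s <= t1 + d / 2 by rewrite ge_min lexx orbT.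
  by move: t1r; lra.
have G_early : iint r s G < eps.
  apply: le_lt_trans (d0P _ _ r0 rs st _); last first.
    by rewrite (lt_le_trans srd)// ge_min lexx.
  by apply: le_trans (ler_norm _) (ler_norm_iint _ _ _).
have G_late : iint s t G <= - k0 * (t - s).
  have [->|st'] := eqVneq s t.
    by rewrite /iint set_itv1 Rintegral_set1 subrr mulr0.
  have {}st' : s < t by rewrite lt_neqAle st'.
  have t1s' : t1 < s by rewrite lt_min (le_lt_trans t1s st') ltrDl.
  rewrite -iint_cst//; apply: le_iint => // [|u su ut].
    exact: segment_integrable_cst.
  apply: decG; first exact: le_trans su.
  by apply: le_lt_trans (above u (lt_le_trans t1s' su) ut); rewrite le_max lexx.
have := VG r t r0 (le_trans rs st); rewrite (iint_cat iG r0 rs st).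
have := b_drop r t (le_trans rs st).
have : k0 * (s - r) <= k0 * d by rewrite ler_wpM2l// ltW.
by move: k0d epsP Vr G_early G_late; rewrite !mulrBr; lra.
Qed.

End Increments.

(** * The Euclidean norm *)

Section EuclideanNorm.
Context {R : realType}.

Lemma sum_ord_const p (r : R) : \sum_(k < p) r = p%:R * r.
Proof. by rewrite sumr_const card_ord mulr_natl. Qed.

Lemma dotvv_ge0 p (u : 'rV[R]_p) : 0 <= dotv u u.
Proof. by apply: sumr_ge0 => k _; rewrite -expr2 sqr_ge0. Qed.

Lemma enorm_ge0 p (u : 'rV[R]_p) : 0 <= enorm u.
Proof. exact: sqrtr_ge0. Qed.

Lemma sqr_enorm p (u : 'rV[R]_p) : enorm u ^+ 2 = dotv u u.
Proof. by rewrite sqr_sqrtr// dotvv_ge0. Qed.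

Lemma enorm_sum p (u : 'rV[R]_p) : enorm u ^+ 2 = \sum_k u 0 k ^+ 2.
Proof. by rewrite sqr_enorm; apply: eq_bigr => k _; rewrite expr2. Qed.

Lemma ler_enorm p1 p2 (u : 'rV[R]_p1) (v : 'rV[R]_p2) :
  (enorm u <= enorm v) = (enorm u ^+ 2 <= enorm v ^+ 2).
Proof. by rewrite ler_sqr ?nnegrE ?enorm_ge0. Qed.

Lemma enormBC p (u v : 'rV[R]_p) : enorm (u - v) = enorm (v - u).
Proof.
rewrite /enorm; congr Num.sqrt; apply: eq_bigr => k _.
by rewrite !mxE; ring.
Qed.

Lemma ler_enorm_coord p (u : 'rV[R]_p) k : `|u 0 k| <= enorm u.
Proof.
rewrite -ler_sqr ?nnegrE ?enorm_ge0// real_normK ?num_real// enorm_sum.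
by rewrite (bigD1 k)//= lerDl sumr_ge0// => *; exact: sqr_ge0.
Qed.

Lemma enorm_eq0 p (u : 'rV[R]_p) : enorm u = 0 -> u = 0.
Proof.
move=> u0; apply/rowP => k; rewrite mxE; apply/eqP; rewrite -normr_eq0.
by rewrite eq_le normr_ge0 andbT -u0 ler_enorm_coord.
Qed.

Lemma dotv_le p (u v : 'rV[R]_p) : dotv u v <= enorm u * enorm v.
Proof.
have [uv0|] := eqVneq (enorm u * enorm v) 0.
  rewrite uv0 /dotv; move/eqP : uv0; rewrite mulf_eq0 => /orP[]/eqP/enorm_eq0 ->;
  by rewrite big1// => k _; rewrite mxE ?mul0r ?mulr0.
move=> uv_neq0; have uv : 0 < enorm u * enorm v.
  by rewrite lt_neqAle eq_sym uv_neq0 mulr_ge0// enorm_ge0.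
rewrite -(ler_pM2l uv).
have := dotvv_ge0 (enorm v *: u - enorm u *: v).
rewrite [X in 0 <= X -> _](_ : _ = enorm v ^+ 2 * dotv u u + enorm u ^+ 2 * dotv v v
    - 2 * (enorm u * enorm v) * dotv u v); last first.
  rewrite /dotv !mulr_sumr -big_split/= -sumrB; apply: eq_bigr => k _.
  by rewrite !mxE; ring.
rewrite -!sqr_enorm.
move: (enorm u) (enorm v) (dotv u v) => a b c h.
suff : 0 <= 2 * (a * b * (a * b) - a * b * c) by lra.
by rewrite (le_trans h)// le_eqVlt; apply/orP; left; apply/eqP; ring.
Qed.

Lemma ler_enormD p (u v : 'rV[R]_p) : enorm (u + v) <= enorm u + enorm v.
Proof.
rewrite -ler_sqr ?nnegrE ?addr_ge0 ?enorm_ge0//.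
have -> : enorm (u + v) ^+ 2 = enorm u ^+ 2 + 2 * dotv u v + enorm v ^+ 2.
  rewrite !sqr_enorm /dotv mulr_sumr -!big_split/=; apply: eq_bigr => k _.
  by rewrite !mxE; ring.
by have := dotv_le u v; lra.
Qed.

Lemma enorm_triangle p (v u w : 'rV[R]_p) :
  enorm (u - w) <= enorm (u - v) + enorm (v - w).
Proof. by rewrite (_ : u - w = (u - v) + (v - w)) ?ler_enormD// addrA subrK. Qed.

Lemma ler_enorm_sum p (u : 'rV[R]_p) : enorm u <= \sum_k `|u 0 k|.
Proof.
have s0 : 0 <= \sum_k `|u 0 k| by apply: sumr_ge0.
rewrite -ler_sqr ?nnegrE ?enorm_ge0// enorm_sum [leRHS]expr2 mulr_suml.
apply: ler_sum => k _.
rewrite -(real_normK (num_real (u 0 k))) expr2 ler_wpM2l//.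
by rewrite (bigD1 k)//= lerDl sumr_ge0.
Qed.

Lemma sqr_enorm_row_mx p1 p2 (u : 'rV[R]_p1) (v : 'rV[R]_p2) :
  enorm (row_mx u v) ^+ 2 = enorm u ^+ 2 + enorm v ^+ 2.
Proof.
rewrite !enorm_sum big_split_ord/=; congr (_ + _); apply: eq_bigr => k _.
  by rewrite row_mxEl.
by rewrite row_mxEr.
Qed.

Lemma sqr_enorm_mxvec p1 p2 (A : 'M[R]_(p1, p2)) :
  enorm (mxvec A) ^+ 2 = \sum_i \sum_j A i j ^+ 2.
Proof.
rewrite enorm_sum (reindex _ (curry_mxvec_bij _ _)) /= pair_bigA/=.
by apply: eq_bigr => -[i j] _ /=; rewrite mxvecE.
Qed.

Lemma enorm0 p : enorm (0 : 'rV[R]_p) = 0.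
Proof. by rewrite /enorm /dotv big1 ?sqrtr0// => k _; rewrite mxE mul0r. Qed.

Lemma dotv_le_ball p (u v : 'rV[R]_p) : dotv u u <= dotv v v -> dotv u v <= dotv v v.
Proof.
rewrite -!sqr_enorm => uv; apply: le_trans (dotv_le u v) _.
by rewrite expr2 ler_wpM2r ?enorm_ge0// ler_enorm.
Qed.

Lemma dotvBl p (u v w : 'rV[R]_p) : dotv (u - v) w = dotv u w - dotv v w.
Proof.
by rewrite /dotv -sumrB; apply: eq_bigr => k _; rewrite !mxE mulrBl.
Qed.

Lemma dotvZr p a (u v : 'rV[R]_p) : dotv u (a *: v) = a * dotv u v.
Proof.
by rewrite /dotv mulr_sumr; apply: eq_bigr => k _; rewrite !mxE mulrCA.
Qed.

Lemma dotvBr p (u v w : 'rV[R]_p) : dotv u (v - w) = dotv u v - dotv u w.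
Proof.
by rewrite /dotv -sumrB; apply: eq_bigr => k _; rewrite !mxE mulrBr.
Qed.

Lemma sqr_enormB_le p (u v : 'rV[R]_p) (w : R) : dotv u u <= w -> dotv v v <= w ->
  dotv (u - v) (u - v) <= 4 * w.
Proof.
move=> uw vw; apply: (@le_trans _ _ (2 * dotv u u + 2 * dotv v v)); last by lra.
rewrite /dotv !mulr_sumr -big_split/=; apply: ler_sum => k _.
rewrite !mxE -subr_ge0.
rewrite (_ : _ - _ = (u 0 k + v 0 k) ^+ 2) ?sqr_ge0//; ring.
Qed.

End EuclideanNorm.

(** * Consensus on a connected graph *)

Section Consensus.
Context {R : realType} {N : nat}.
Implicit Types (e : rel 'I_N) (u : 'I_N -> R).

(** The quadratic form of the graph Laplacian plus the diagonal matrix that pins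
    the neighbours of j: it governs the estimates of the action of player j. *)
Definition pinned_form e (j : 'I_N) u : R :=
  \sum_i u i * (\sum_k (e k i)%:R * (u i - u k) + (e j i)%:R * u i).

(** Symmetry of the graph pairs the two orientations of every edge. *)
Lemma pinned_formE e j u : symmetric e ->
  pinned_form e j u = (\sum_i \sum_k (e k i)%:R * (u i - u k) ^+ 2) / 2
                      + \sum_i (e j i)%:R * u i ^+ 2.
Proof.
move=> se; rewrite /pinned_form.
under eq_bigr do rewrite mulrDr.
rewrite big_split/=; congr (_ + _); last by apply: eq_bigr => i _; ring.
under eq_bigr do rewrite mulr_sumr.
apply: (@mulIf _ 2) => //; rewrite divfK// mulrDr mulr1.
rewrite [in X in _ + X]exchange_big/= -big_split/=; apply: eq_bigr => i _.
rewrite -big_split/=; apply: eq_bigr => k _; rewrite (se i k); ring.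
Qed.

Lemma pinned_form_ge0 e j u : symmetric e -> 0 <= pinned_form e j u.
Proof.
move=> se; rewrite pinned_formE// addr_ge0 ?divr_ge0//.
  by apply: sumr_ge0 => i _; apply: sumr_ge0 => k _; rewrite mulr_ge0 ?sqr_ge0.
by apply: sumr_ge0 => i _; rewrite mulr_ge0 ?sqr_ge0.
Qed.

Lemma pinned_form_edge e j u i k : symmetric e -> e k i ->
  (u i - u k) ^+ 2 <= 2 * pinned_form e j u.
Proof.
move=> se eki; rewrite pinned_formE//.
have pos2 : 0 <= \sum_i (e j i)%:R * u i ^+ 2.
  by apply: sumr_ge0 => l _; rewrite mulr_ge0 ?sqr_ge0.
suff : (u i - u k) ^+ 2 <= \sum_i \sum_k (e k i)%:R * (u i - u k) ^+ 2 by lra.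
rewrite (bigD1 i)//= (bigD1 k)//= eki mul1r -addrA lerDl addr_ge0//.
  by apply: sumr_ge0 => l _; rewrite mulr_ge0 ?sqr_ge0.
apply: sumr_ge0 => l _; apply: sumr_ge0 => l' _.
by rewrite mulr_ge0 ?sqr_ge0.
Qed.

Lemma pinned_form_pin e j u i : symmetric e -> e j i ->
  u i ^+ 2 <= pinned_form e j u.
Proof.
move=> se eji; rewrite pinned_formE// ler_wpDl//.
  rewrite divr_ge0//; apply: sumr_ge0 => l _; apply: sumr_ge0 => l' _.
  by rewrite mulr_ge0 ?sqr_ge0.
rewrite (bigD1 i)//= eji mul1r lerDl.
by apply: sumr_ge0 => l _; rewrite mulr_ge0 ?sqr_ge0.
Qed.

(** The form bounds u at a neighbour of j and the difference of u along every
    edge, hence u at every vertex by following a path.  Two vertices are needed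
    for j to have a neighbour. *)
Lemma pinned_form_coercive e : symmetric e -> (forall i j, connect e i j) ->
  (1 < N)%N ->
  exists2 C : R, 0 < C & forall j u, \sum_i u i ^+ 2 <= C * pinned_form e j u.
Proof.
move=> se ce N1.
suff coord j i : exists2 C : R, 0 <= C & forall u, u i ^+ 2 <= C * pinned_form e j u.
  have /choice[C CP] : forall ji : 'I_N * 'I_N, exists C : R,
      0 <= C /\ forall u, u ji.2 ^+ 2 <= C * pinned_form e ji.1 u.
    by move=> [j i]; have [C] := coord j i; exists C.
  exists (1 + \sum_j \sum_i C (j, i)) => [|j u].
    rewrite ltr_pwDl//; apply: sumr_ge0 => j _; apply: sumr_ge0 => i _.
    by have [] := CP (j, i).
  apply: (@le_trans _ _ ((\sum_i C (j, i)) * pinned_form e j u)).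
    by rewrite mulr_suml; apply: ler_sum => i _; have [_] := CP (j, i); exact.
  rewrite ler_wpM2r ?pinned_form_ge0// ler_wpDl//.
  rewrite [leRHS](bigD1 j)//= lerDl; apply: sumr_ge0 => k _.
  by apply: sumr_ge0 => i _; have [] := CP (k, i).
have [i0 eji0] : exists i0, e j i0.
  have [k kj] : exists k : 'I_N, k != j.
    have [j0|j0] := eqVneq (j : nat) 0%N.
      by exists (Ordinal N1); rewrite -val_eqE/= j0.
    by exists (Ordinal (ltnW N1)); rewrite -val_eqE/= eq_sym.
  have /connectP[[|l p] /=] := ce j k; last by case/andP => ejl _ _; exists l.
  by move=> _ kj'; rewrite kj' eqxx in kj.
have /connectP[p] := ce i0 i.
have : exists2 C : R, 0 <= C & forall u, u i0 ^+ 2 <= C * pinned_form e j u.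
  by exists 1 => // u; rewrite mul1r pinned_form_pin.
elim: p i0 {eji0} => [|l p ih] i0 hi0 /=; first by move=> _ ->.
case/andP => el pl iE; apply: (ih l) => //.
have [C C0 CP] := hi0; exists (2 * C + 4) => [|u]; first by lra.
have h1 := CP u; have h2 := @pinned_form_edge e j u l i0 se el.
(* This square is u_l^2 <= 2 u_i0^2 + 2 (u_l - u_i0)^2 in disguise. *)
have : 0 <= (u l - 2 * u i0) ^+ 2 by exact: sqr_ge0.
by rewrite mulrDl; move: h1 h2; lra.
Qed.

End Consensus.

(** * The smooth robust term and the first-order Nash condition *)

Section Tanh.
Context {R : realType}.

(** With w = 2 kappa |r| / epsilon the claim is w <= kappa (exp w + 1).  As
    kappa exp w = exp (w - kappa - 1) by the choice of kappa, this is the tangent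
    inequality 1 + a <= exp a at a = w - kappa - 1: kappa is the constant for
    which w - kappa is tangent to kappa exp w. *)
Lemma tanh_gap (kappa epsilon r : R) : kappa = expR (- (kappa + 1)) -> 0 < epsilon ->
  `|r| - r * tanh (kappa * r / epsilon) <= epsilon.
Proof.
move=> kE eps0; have k0 : 0 < kappa by rewrite kE expR_gt0.
have tanhN (a : R) : tanh (- a) = - tanh a.
  by rewrite /tanh opprK -mulNr opprB; congr (_ / _); rewrite addrC.
wlog r0 : r / 0 <= r.
  move=> h; have [/h//|/ltW r0] := leP 0 r.
  have := h (- r); rewrite oppr_ge0 => /(_ r0).
  by rewrite normrN (mulrN kappa) !mulNr tanhN mulrN opprK.
rewrite ger0_norm//; set u := kappa * r / epsilon.
have -> : r = epsilon / kappa * u by rewrite /u; field; rewrite !gt_eqF.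
have u0 : 0 <= u by rewrite divr_ge0 ?mulr_ge0// ltW.
have -> : epsilon / kappa * u - epsilon / kappa * u * tanh u =
          epsilon * (u * (1 - tanh u) / kappa) by field; rewrite gt_eqF.
rewrite ger_pMr// ler_pdivrMr// mul1r.
have e0 : 0 < expR u := expR_gt0 u.
have -> : 1 - tanh u = 2 / (expR (2 * u) + 1).
  rewrite /tanh (_ : 2 * u = u + u); last by ring.
  rewrite expRN expRD; field.
  by rewrite !gt_eqF// ?addr_gt0 ?mulr_gt0.
have d0 : 0 < expR (2 * u) + 1 by rewrite addr_gt0 ?expR_gt0.
rewrite mulrA ler_pdivrMr//.
have : 2 * u - kappa <= kappa * expR (2 * u).
  rewrite {2}kE -expRD; apply: le_trans (expR_ge1Dx _); lra.
by rewrite mulrDr; lra.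
Qed.

End Tanh.

Lemma nash_grad_eq0 (R : realType) (n m : nat) (P : plant R n m) xs i :
  nash_equilibrium P xs -> has_partial i (cost P i) -> grad P i xs = 0.
Proof.
move=> nash hp; pose f : R -> R^o := fun t => cost P i (t *: delta_mx 0 i + xs).
have df t : derivable f t 1.
  apply/derivable1P; have /derivable1P := hp (t *: delta_mx 0 i + xs).
  suff -> : (fun h : R => f (h *: (1 : R^o) + t)) =
    (fun h : R => cost P i (h *: delta_mx 0 i + (t *: delta_mx 0 i + xs))) by [].
  apply/funext => h; rewrite /f.
  by rewrite scalerDl addrA [h *: (1 : R^o)]mulr1.
have fmin t : f 0 <= f t.
  rewrite /f scale0r add0r; apply: le_trans (nash i (xs 0 i + t)) _.
  rewrite le_eqVlt; apply/orP; left; apply/eqP; congr (cost P i _).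
  apply/rowP => j; rewrite !mxE eqxx/=; case: eqVneq => [->|_]; last by rewrite mulr0 add0r.
  by rewrite mulr1 addrC.
have le11 : (- 1 : R) <= 1 by lra.
have in0 : (0 : R) \in `]- 1, 1[%R by rewrite in_itv/= ltrN10 ltr01.
have [_] := derive1_at_min le11 (fun t _ => df t) in0 (fun t _ => fmin t).
move=> D; rewrite -[RHS]D /grad /partial /derive; congr (lim _).
suff -> : (fun h : R => h^-1 *: ((cost P i \o shift xs) (h *: delta_mx 0 i) - cost P i xs)) =
  (fun h : R => h^-1 *: ((f \o shift 0) (h *: (1 : R^o)) - f 0) : R^o) by [].
apply/funext => h /=; rewrite /f.
by rewrite scale0r add0r [h *: (1 : R^o)]mulr1 addr0.
Qed.

(** * Rates of the error coordinates *)

Section ErrorDynamics.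
Context {R : realType} {n m : nat}.
Variables (P : plant R n m) (nn : network R (n + m)) (c : params R).
Variables (xs : 'rV[R]_(n + m)) (L : R).
Local Notation N := (n + m)%N.
Hypotheses (L_ge0 : 0 <= L) (k2_ge0 : 0 <= k2 c) (k3_ge0 : 0 <= k3 c).
Hypothesis grad_lip : forall i, elipschitz L (grad P i).
Hypothesis drift_lip : forall i, elipschitz L (drift P i).
Hypothesis grad_xs : forall i, grad P i xs = 0.

Definition disagreement (s : state nn) : 'M[R]_N :=
  \matrix_(i, j) (st_y s i j - xbar s 0 j).

(** The derivative of xbar along the closed loop. *)
Definition xbar_rate (s : state nn) : 'rV[R]_N :=
  row_mx (\row_k (- k2 c * grad P (lshift m k) (est s (lshift m k)))) (st_v s).

(** A bound on the speed of k2 grad_i f_i (y_i): the gradient is L-Lipschitz and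
    the Euclidean speed of y_i is at most the sum of its coordinate speeds. *)
Definition grad_rate_bound (s : state nn) (i : 'I_N) : R :=
  k2 c * (L * \sum_j `|estimator_law P c s i j|).

Variable s : state nn.
Local Notation x := (enorm (xbar s - xs)).
Local Notation y := (enorm (mxvec (disagreement s))).
Local Notation f := (enorm (lsubmx (err P c s))).
Local Notation g := (enorm (rsubmx (err P c s))).

Lemma ler_disagreement i j : `|disagreement s i j| <= y.
Proof. by rewrite -mxvecE; exact: ler_enorm_coord. Qed.

Lemma enorm_est i : enorm (est s i - xbar s) <= y.
Proof.
rewrite ler_enorm sqr_enorm_mxvec enorm_sum [leRHS](bigD1 i)//=.
have -> : \sum_j (est s i - xbar s) 0 j ^+ 2 = \sum_j disagreement s i j ^+ 2.
  by apply: eq_bigr => j _; rewrite !mxE.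
by rewrite lerDl; do 2 (apply: sumr_ge0 => ? _); exact: sqr_ge0.
Qed.

Lemma grad_est_xbar i :
  `|grad P i (est s i) - grad P i (xbar s)| <= L * y.
Proof. by apply: le_trans (grad_lip i _ _) _; rewrite ler_wpM2l// enorm_est. Qed.

Lemma grad_est i : `|grad P i (est s i)| <= L * (x + y).
Proof.
rewrite -[grad _ _ _]subr0 -(grad_xs i); apply: le_trans (grad_lip i _ _) _.
rewrite ler_wpM2l//; apply: le_trans (enorm_triangle (xbar s) _ _) _.
by rewrite addrC lerD2l enorm_est.
Qed.

Lemma st_x_xbar : st_x s - xbar s = row_mx (lsubmx (err P c s)) 0.
Proof.
rewrite /err row_mxKl /xbar -{1}[st_x s]hsubmxK opp_row_mx add_row_mx.
by rewrite subrr.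
Qed.

Lemma enorm_st_x_xbar : enorm (st_x s - xbar s) = f.
Proof.
apply/eqP; rewrite st_x_xbar eq_le !ler_enorm sqr_enorm_row_mx enorm0.
by rewrite expr0n addr0 !lexx.
Qed.

Lemma drift_est i :
  `|drift P i (st_x s) - drift P i (est s i)| <= L * (f + y).
Proof.
apply: le_trans (drift_lip i _ _) _; rewrite ler_wpM2l//.
apply: le_trans (enorm_triangle (xbar s) _ _) _.
by rewrite enorm_st_x_xbar lerD2l enormBC enorm_est.
Qed.

Lemma ler_fst_err k : `|err P c s 0 (lshift m k)| <= f.
Proof.
have -> : err P c s 0 (lshift m k) = lsubmx (err P c s) 0 k by rewrite [RHS]mxE.
exact: ler_enorm_coord.
Qed.

Lemma ler_snd_err k : `|err P c s 0 (rshift n k)| <= g.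
Proof.
have -> : err P c s 0 (rshift n k) = rsubmx (err P c s) 0 k by rewrite [RHS]mxE.
exact: ler_enorm_coord.
Qed.

(** Both kinds of players follow the same gradient play, perturbed by e_s for the
    second-order ones; this is what makes xbar the right set of coordinates. *)
Lemma xbar_rateE j : xbar_rate s 0 j =
  - k2 c * grad P j (est s j) + row_mx 0 (rsubmx (err P c s)) 0 j.
Proof.
rewrite /xbar_rate /err row_mxKr; case: (split_ordP j) => k ->.
  by rewrite !row_mxEl !mxE addr0.
by rewrite !row_mxEr !mxE; ring.
Qed.

Lemma enorm_row0 : enorm (row_mx (0 : 'rV[R]_n) (rsubmx (err P c s))) = g.
Proof.
apply/eqP; rewrite eq_le !ler_enorm sqr_enorm_row_mx enorm0.
by rewrite expr0n add0r !lexx.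
Qed.

Lemma ler_xbar_rate j : `|xbar_rate s 0 j| <= k2 c * (L * (x + y)) + g.
Proof.
rewrite xbar_rateE; apply: le_trans (ler_normD _ _) (lerD _ _).
  by rewrite normrM normrN (ger0_norm k2_ge0) ler_wpM2l// grad_est.
by rewrite -enorm_row0; exact: ler_enorm_coord.
Qed.

(** Strong monotonicity at the exact gradients, plus the price for evaluating
    them at the estimates. *)
Lemma tracking_rate (mconst : R) :
  (forall x z : 'rV[R]_N, mconst * enorm (x - z) ^+ 2 <=
     dotv (x - z) (pseudo_gradient P x - pseudo_gradient P z)) ->
  \sum_j (xbar s - xs) 0 j * xbar_rate s 0 j <=
    - (k2 c * mconst * x ^+ 2) + N%:R * (k2 c * L * (x * y)) + x * g.
Proof.
move=> /(_ (xbar s) xs) mono.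
pose X := xbar s - xs.
have -> : \sum_j X 0 j * xbar_rate s 0 j =
    - (k2 c * dotv X (pseudo_gradient P (xbar s) - pseudo_gradient P xs))
    + \sum_j - (k2 c * (X 0 j * (grad P j (est s j) - grad P j (xbar s))))
    + dotv X (row_mx 0 (rsubmx (err P c s))).
  rewrite /dotv mulr_sumr -sumrN -!big_split/=; apply: eq_bigr => j _.
  by rewrite xbar_rateE !mxE grad_xs; ring.
apply: lerD; last by rewrite -enorm_row0; exact: dotv_le.
apply: lerD; first by rewrite lerN2 -mulrA ler_wpM2l.
apply: (@le_trans _ _ (\sum_(j < N) k2 c * L * (x * y))); last first.
  by rewrite sum_ord_const.
apply: ler_sum => j _; apply: le_trans (ler_norm _) _.
rewrite normrN normrM (ger0_norm k2_ge0) -mulrA ler_wpM2l// normrM mulrCA.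
by rewrite ler_pM// ?ler_enorm_coord// grad_est_xbar.
Qed.

Lemma estimator_lawE i j : estimator_law P c s i j =
  - k3 c * (\sum_k (edge P k i)%:R * (disagreement s i j - disagreement s k j)
            + (edge P j i)%:R * disagreement s i j).
Proof.
have dE k : disagreement s k j = st_y s k j - xbar s 0 j by rewrite mxE.
rewrite /estimator_law /adj; congr (_ * (_ + _)); last by rewrite dE.
by apply: eq_bigr => k _; rewrite !dE; congr (_ * _); ring.
Qed.

Lemma ler_estimator_law i j :
  `|estimator_law P c s i j| <= k3 c * ((2 * N%:R + 1) * y).
Proof.
rewrite estimator_lawE normrM normrN (ger0_norm k3_ge0) ler_wpM2l// mulrDl mul1r.
have bool_mul (b : bool) (r : R) : `|b%:R * r| <= `|r|.
  by rewrite normrM normr_nat; case: b; rewrite ?mul1r// mul0r.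
apply: le_trans (ler_normD _ _) (lerD _ _); last first.
  exact: le_trans (bool_mul _ _) (ler_disagreement _ _).
apply: le_trans (ler_norm_sum _ _ _) _.
apply: (@le_trans _ _ (\sum_(k < N) 2 * y)); last first.
  by rewrite sum_ord_const mulrCA mulrA.
apply: ler_sum => k _; apply: le_trans (bool_mul _ _) _.
apply: le_trans (ler_normB _ _) _.
by have := ler_disagreement i j; have := ler_disagreement k j; lra.
Qed.

(** For fixed j the estimates y_ij are driven to xbar_j by the pinned Laplacian
    while xbar_j itself moves. *)
Lemma consensus_rate (C : R) : 0 < C ->
  (forall j (u : 'I_N -> R), \sum_i u i ^+ 2 <= C * pinned_form (edge P) j u) ->
  \sum_i \sum_j disagreement s i j * (estimator_law P c s i j - xbar_rate s 0 j) <=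
    - (k3 c / C * y ^+ 2) + N%:R ^+ 2 * (y * (k2 c * (L * (x + y)) + g)).
Proof.
move=> C0 coer; pose Y := disagreement s.
have -> : \sum_i \sum_j Y i j * (estimator_law P c s i j - xbar_rate s 0 j) =
    - (k3 c * \sum_j pinned_form (edge P) j (fun i => Y i j))
    + \sum_i \sum_j - (Y i j * xbar_rate s 0 j).
  rewrite /pinned_form mulr_sumr.
  under [X in - X]eq_bigr do rewrite mulr_sumr.
  rewrite [in RHS]exchange_big/= -sumrN -big_split/=; apply: eq_bigr => i _.
  rewrite -sumrN -big_split/=; apply: eq_bigr => j _.
  by rewrite estimator_lawE -/Y/=; ring.
apply: lerD.
  rewrite lerN2 -mulrA ler_wpM2l// sqr_enorm_mxvec exchange_big/=.
  rewrite mulr_sumr; apply: ler_sum => j _.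
  by rewrite mulrC ler_pdivrMr// mulrC coer.
apply: (@le_trans _ _ (\sum_(i < N) \sum_(j < N) y * (k2 c * (L * (x + y)) + g))).
  apply: ler_sum => i _; apply: ler_sum => j _; apply: le_trans (ler_norm _) _.
  by rewrite normrN normrM ler_pM// ?ler_disagreement// ler_xbar_rate.
under eq_bigr do rewrite sum_ord_const.
by rewrite sum_ord_const expr2 mulrA.
Qed.

Section Adaptation.
Variables (i : 'I_N) (Ws : 'rV[R]_(nn_size nn i)) (eps d : R).
Hypothesis kappa_def : kappa c = expR (- (kappa c + 1)).
Hypothesis epsilon_gt0 : 0 < epsilon c.
Hypothesis delta_ge0 : 0 <= delta c.
Hypothesis drift_nn : drift P i (est s i) = dotv Ws (Defs.basis nn i (est s i)) + eps.
Hypothesis robust : `|eps| + `|d| <= delta c.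

Local Notation e := (err P c s 0 i).

(** Writing the drift at the actions as the drift at the estimate plus a Lipschitz
    remainder, the network cancels Ws . S, and eps + d is absorbed by the robust
    term. *)
Lemma compensation_rate :
  e * (- nn_output s i - phi P c s i + drift P i (st_x s) + d) <=
  - (e * dotv (st_W s i - Ws) (Defs.basis nn i (est s i))) + epsilon c
  + `|e| * (L * (f + y)).
Proof.
rewrite /nn_output dotvBl; set S := Defs.basis _ _ _.
set D := drift P i (st_x s) - drift P i (est s i).
have -> : e * (- dotv (st_W s i) S - phi P c s i + drift P i (st_x s) + d) =
    - (e * (dotv (st_W s i) S - dotv Ws S)) + (e * (eps + d) - e * phi P c s i) + e * D.
  by rewrite /D drift_nn; ring.
apply: lerD; [apply: lerD => //|]; last first.
  by apply: le_trans (ler_norm _) _; rewrite normrM ler_wpM2l// drift_est.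
have := tanh_gap (delta c * e) kappa_def epsilon_gt0.
rewrite normrM (ger0_norm delta_ge0) => gap.
have : e * (eps + d) <= `|e| * delta c.
  apply: le_trans (ler_norm _) _; rewrite normrM ler_wpM2l//.
  exact: le_trans (ler_normD _ _) robust.
have -> : e * phi P c s i =
    delta c * e * tanh (kappa c * (delta c * e) / epsilon c).
  by rewrite /phi !mulrA; ring.
by move: gap; lra.
Qed.

Hypothesis beta_gt0 : 0 < beta c.
Hypothesis Wmax_gt0 : 0 < Wmax c.
Hypothesis Ws_ball : dotv Ws Ws <= Wmax c.

(** Beyond the ball the law subtracts the radial component of beta e S. *)
Lemma weight_law_outside : Wmax c < dotv (st_W s i) (st_W s i) ->
  \sum_l st_W s i 0 l * weight_law P c s i 0 l = 0.
Proof.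
move=> out; rewrite /weight_law ltNge (ltW out)/= gt_eqF//=.
set W := st_W s i; set S := Defs.basis _ _ _.
have W0 : dotv W W != 0 by rewrite gt_eqF// (lt_trans Wmax_gt0).
rewrite -/(dotv _ _) dotvBr !dotvZr.
by field.
Qed.

(** On the sphere the subtracted radial term has the sign of (W - Ws) . W, which
    is nonnegative because Ws lies in the ball. *)
Lemma adaptation_rate : dotv (st_W s i) (st_W s i) <= Wmax c ->
  \sum_l (st_W s i - Ws) 0 l * weight_law P c s i 0 l <=
  beta c * (e * dotv (st_W s i - Ws) (Defs.basis nn i (est s i))).
Proof.
move=> Wball; rewrite /weight_law.
set W := st_W s i in Wball *; set S := Defs.basis _ _ _.
rewrite -/(dotv _ _).
case: ifPn => [_|]; first by rewrite dotvZr mulrA.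
rewrite negb_or -leNgt => /andP[WW].
(* Within the ball the last branch of the law is reached on the sphere only. *)
have {Wball WW} WWE : dotv W W = Wmax c by apply/le_anti; rewrite Wball.
rewrite WWE eqxx/= -leNgt => eWS.
rewrite dotvBr !dotvZr -mulrA gerBl mulr_ge0//.
  by rewrite mulr_ge0 ?divr_ge0// ltW.
by rewrite dotvBl subr_ge0 dotv_le_ball// WWE.
Qed.

End Adaptation.

Lemma fst_error_rate k (d w : R) : 
  let i := lshift m k in let e := err P c s 0 i in
  e * (- nn_output s i - phi P c s i + drift P i (st_x s) + d) <= w ->
  e * (control_fst P c s k + drift P i (st_x s) + d - - k2 c * grad P i (est s i)) <=
  - (k1 c * e ^+ 2) + w + f * (k2 c * (L * (x + y))).
Proof.
move=> i e hw.
have eE : e = st_x s 0 i - st_z s 0 k by rewrite /e/err row_mxEl !mxE.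
have -> : e * (control_fst P c s k + drift P i (st_x s) + d - - k2 c * grad P i (est s i)) =
  - (k1 c * e ^+ 2) + e * (- nn_output s i - phi P c s i + drift P i (st_x s) + d)
  + e * (k2 c * grad P i (est s i)).
  rewrite /control_fst -/i -eE; ring.
apply: lerD; [exact: lerD|apply: le_trans (ler_norm _) _].
rewrite normrM ler_pM// ?ler_fst_err// normrM (ger0_norm k2_ge0) ler_wpM2l//.
exact: grad_est.
Qed.

Lemma snd_error_rate k (d w : R) : 
  let i := rshift n k in let e := err P c s 0 i in
  e * (- nn_output s i - phi P c s i + drift P i (st_x s) + d) <= w ->
  e * (control_snd P c s k + drift P i (st_x s) + d) + `|e| * grad_rate_bound s i <=
  - (k4 c * e ^+ 2) + w
  + g * (k2 c * (L * (N%:R * (k3 c * ((2 * N%:R + 1) * y))))).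
Proof.
move=> i e hw.
have vE : st_v s 0 k = e - k2 c * grad P i (est s i).
  by rewrite /e /err row_mxEr !mxE addrC addKr.
have -> : e * (control_snd P c s k + drift P i (st_x s) + d) =
  - (k4 c * e ^+ 2) + e * (- nn_output s i - phi P c s i + drift P i (st_x s) + d).
  by rewrite /control_snd vE -/i; ring.
apply: lerD; first exact: lerD.
apply: ler_pM => //; first by rewrite !mulr_ge0// sumr_ge0.
  exact: ler_snd_err.
rewrite !ler_wpM2l//.
apply: (@le_trans _ _ (\sum_(j < N) k3 c * ((2 * N%:R + 1) * y))).
  by apply: ler_sum => j _; exact: ler_estimator_law.
by rewrite sum_ord_const.
Qed.

End ErrorDynamics.

(** * The Lyapunov function *)

Section GainDomination.
Context {R : realType}.
Implicit Types a b theta x y f g mu B C : R.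

Lemma young a b theta : 0 < theta -> a * b <= theta * a ^+ 2 + b ^+ 2 / (4 * theta).
Proof.
move=> theta0; rewrite -subr_ge0.
have -> : theta * a ^+ 2 + b ^+ 2 / (4 * theta) - a * b =
    (2 * theta * a - b) ^+ 2 / (4 * theta) by field; rewrite gt_eqF.
by rewrite divr_ge0 ?sqr_ge0// mulr_ge0// ltW.
Qed.

(** Each cross term that contains x is charged with weight mu, since the decay
    in x is tied to k2 and cannot be enlarged; everything else goes to y, f and g,
    whose decay rates are free.  C stands for the gain of the product g y, which
    grows with k3: y gets weight 1 and g gets weight C^2, so that the lower
    bound imposed on k3 is free of k3. *)
Lemma cross_terms_le x y f g mu B C : 0 < mu -> 0 <= B ->
  B * (x * y + x * g + y * y + y * g + f * f + f * y + f * x + f * g) + C * (g * y) <=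
  3 * mu * x ^+ 2 + (B ^+ 2 / (4 * mu) + 3 * B + 1) * y ^+ 2
  + (B ^+ 2 / (4 * mu) + 3 * B) * f ^+ 2
  + (B ^+ 2 / (4 * mu) + 2 * B + C ^+ 2) * g ^+ 2.
Proof.
move=> mu0 B0; set D := B ^+ 2 / (4 * mu).
have h (a : R) : B * (x * a) <= mu * x ^+ 2 + D * a ^+ 2.
  have := young x (B * a) mu0.
  by rewrite mulrCA (_ : (B * a) ^+ 2 / (4 * mu) = D * a ^+ 2)// /D; ring.
have amgm (a b : R) : B * (a * b) <= B * a ^+ 2 + B * b ^+ 2.
  rewrite -mulrDr ler_wpM2l//.
  by have := sqr_ge0 (a - b); have := sqr_ge0 a; have := sqr_ge0 b; rewrite sqrrB; lra.
have hC : C * (g * y) <= y ^+ 2 + C ^+ 2 * g ^+ 2.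
  rewrite -subr_ge0.
  have := sqr_ge0 (y - C * g); have := sqr_ge0 y; have := sqr_ge0 (C * g).
  rewrite sqrrB exprMn; lra.
have := h y; have := h g; have := h f.
have := amgm y g; have := amgm f y; have := amgm f g; move: hC.
by rewrite (mulrC f x) !mulrDr !mulrDl -!expr2 -!mulrA; lra.
Qed.

End GainDomination.

Section Lyapunov.
Context {R : realType} {n m : nat}.
Variables (P : plant R n m) (nn : network R (n + m)) (c : params R).
Variables (xs : 'rV[R]_(n + m)) (Ws : forall i : 'I_(n + m), 'rV[R]_(nn_size nn i)).
Variable L : R.
Local Notation N := (n + m)%N.

Definition lyapunov (s : state nn) : R :=
  \sum_j (xbar s - xs) 0 j ^+ 2 / 2
  + \sum_i \sum_j disagreement s i j ^+ 2 / 2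
  + \sum_(k < n) err P c s 0 (lshift m k) ^+ 2 / 2
  + \sum_(k < m) err P c s 0 (rshift n k) ^+ 2 / 2
  + (beta c)^-1 * \sum_i \sum_l (st_W s i - Ws i) 0 l ^+ 2 / 2.

(** The formal derivative of [lyapunov] for disturbance values d, except that the
    derivative of k2 grad_i f_i (y_i) is replaced by its bound. *)
Definition lyapunov_rate (s : state nn) (d : 'I_N -> R) : R :=
  \sum_j (xbar s - xs) 0 j * xbar_rate P c s 0 j
  + \sum_i \sum_j disagreement s i j * (estimator_law P c s i j - xbar_rate P c s 0 j)
  + \sum_(k < n) (let i := lshift m k in
      err P c s 0 i * (control_fst P c s k + drift P i (st_x s) + d i
                       - - k2 c * grad P i (est s i)))
  + \sum_(k < m) (let i := rshift n k in
      err P c s 0 i * (control_snd P c s k + drift P i (st_x s) + d i)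
      + `|err P c s 0 i| * grad_rate_bound P c L s i)
  + (beta c)^-1 * \sum_i \sum_l (st_W s i - Ws i) 0 l * weight_law P c s i 0 l.

Lemma lyapunovE s : lyapunov s =
  (enorm (xbar s - xs) ^+ 2 + enorm (mxvec (disagreement s)) ^+ 2
   + enorm (lsubmx (err P c s)) ^+ 2 + enorm (rsubmx (err P c s)) ^+ 2) / 2
  + (\sum_i dotv (st_W s i - Ws i) (st_W s i - Ws i)) / (2 * beta c).
Proof.
rewrite /lyapunov sqr_enorm_mxvec !enorm_sum; congr (_ + _); last first.
  rewrite mulr_sumr mulr_suml; apply: eq_bigr => i _.
  by rewrite -mulr_suml -enorm_sum sqr_enorm mulrCA -invfM (mulrC (beta c)).
rewrite !mulrDl !mulr_suml; congr (_ + _ + _ + _).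
- by apply: eq_bigr => i _; rewrite mulr_suml.
- by apply: eq_bigr => k _; rewrite [in RHS]mxE.
- by apply: eq_bigr => k _; rewrite [in RHS]mxE.
Qed.

Hypotheses (L_ge0 : 0 <= L) (k2_ge0 : 0 <= k2 c) (k3_ge0 : 0 <= k3 c).
Hypotheses (delta_ge0 : 0 <= delta c) (epsilon_gt0 : 0 < epsilon c).
Hypothesis kappa_def : kappa c = expR (- (kappa c + 1)).
Hypotheses (beta_gt0 : 0 < beta c) (Wmax_gt0 : 0 < Wmax c).
Hypothesis grad_lip : forall i, elipschitz L (grad P i).
Hypothesis drift_lip : forall i, elipschitz L (drift P i).
Hypothesis grad_xs : forall i, grad P i xs = 0.
Hypothesis Ws_ball : forall i, dotv (Ws i) (Ws i) <= Wmax c.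

Section Rate.
Variables (mconst C : R).
Hypothesis mono : forall x z : 'rV[R]_N, mconst * enorm (x - z) ^+ 2 <=
  dotv (x - z) (pseudo_gradient P x - pseudo_gradient P z).
Hypothesis C_gt0 : 0 < C.
Hypothesis coer : forall j (u : 'I_N -> R),
  \sum_i u i ^+ 2 <= C * pinned_form (edge P) j u.

Variables (s : state nn) (eps d : 'I_N -> R).
Hypothesis drift_nn : forall i,
  drift P i (est s i) = dotv (Ws i) (Defs.basis nn i (est s i)) + eps i.
Hypothesis robust : forall i, `|eps i| + `|d i| <= delta c.
Hypothesis W_ball : forall i, dotv (st_W s i) (st_W s i) <= Wmax c.

Local Notation x := (enorm (xbar s - xs)).
Local Notation y := (enorm (mxvec (disagreement s))).
Local Notation f := (enorm (lsubmx (err P c s))).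
Local Notation g := (enorm (rsubmx (err P c s))).

(** The terms w i, the products of e_i with the network error, cancel between the
    error coordinates and the weights. *)
Lemma lyapunov_rate_le : lyapunov_rate s d <=
  - (k2 c * mconst * x ^+ 2) + N%:R * (k2 c * L * (x * y)) + x * g
  + (- (k3 c / C * y ^+ 2) + N%:R ^+ 2 * (y * (k2 c * (L * (x + y)) + g)))
  + (- (k1 c * f ^+ 2) + n%:R * (f * (L * (f + y)) + f * (k2 c * (L * (x + y)))))
  + (- (k4 c * g ^+ 2) + m%:R * (g * (L * (f + y))
     + g * (k2 c * (L * (N%:R * (k3 c * ((2 * N%:R + 1) * y)))))))
  + N%:R * epsilon c.
Proof.
pose w i := err P c s 0 i * dotv (st_W s i - Ws i) (Defs.basis nn i (est s i)).
have comp i : err P c s 0 i *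
      (- nn_output s i - phi P c s i + drift P i (st_x s) + d i) <=
    - w i + epsilon c + `|err P c s 0 i| * (L * (f + y)).
  exact: compensation_rate (drift_nn i) (robust i).
have fy0 : 0 <= L * (f + y) by rewrite mulr_ge0// addr_ge0// enorm_ge0.
have fst_le : \sum_(k < n) (let i := lshift m k in
      err P c s 0 i * (control_fst P c s k + drift P i (st_x s) + d i
                       - - k2 c * grad P i (est s i))) <=
    - (k1 c * f ^+ 2) + n%:R * (f * (L * (f + y)) + f * (k2 c * (L * (x + y))))
    + n%:R * epsilon c - \sum_(k < n) w (lshift m k).
  apply: (@le_trans _ _ (\sum_(k < n) (- (k1 c * err P c s 0 (lshift m k) ^+ 2)
      + (- w (lshift m k) + epsilon c + f * (L * (f + y)))
      + f * (k2 c * (L * (x + y)))))).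
    apply: ler_sum => k _; apply: fst_error_rate => //.
    apply: le_trans (comp _) _; rewrite lerD2l ler_wpM2r//; exact: ler_fst_err.
  rewrite enorm_sum mulr_sumr.
  under [in leRHS]eq_bigr do rewrite mxE.
  rewrite !big_split/= !sumrN !sum_ord_const; lra.
have snd_le : \sum_(k < m) (let i := rshift n k in
      err P c s 0 i * (control_snd P c s k + drift P i (st_x s) + d i)
      + `|err P c s 0 i| * grad_rate_bound P c L s i) <=
    - (k4 c * g ^+ 2) + m%:R * (g * (L * (f + y))
     + g * (k2 c * (L * (N%:R * (k3 c * ((2 * N%:R + 1) * y))))))
    + m%:R * epsilon c - \sum_(k < m) w (rshift n k).
  apply: (@le_trans _ _ (\sum_(k < m) (- (k4 c * err P c s 0 (rshift n k) ^+ 2)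
      + (- w (rshift n k) + epsilon c + g * (L * (f + y)))
      + g * (k2 c * (L * (N%:R * (k3 c * ((2 * N%:R + 1) * y)))))))).
    apply: ler_sum => k _; apply: snd_error_rate => //.
    apply: le_trans (comp _) _; rewrite lerD2l ler_wpM2r//; exact: ler_snd_err.
  rewrite [in leRHS]enorm_sum mulr_sumr.
  under [in leRHS]eq_bigr do rewrite mxE.
  rewrite !big_split/= !sumrN !sum_ord_const; lra.
have W_le : (beta c)^-1 * \sum_i \sum_l (st_W s i - Ws i) 0 l * weight_law P c s i 0 l
    <= \sum_(k < n) w (lshift m k) + \sum_(k < m) w (rshift n k).
  have -> : \sum_(k < n) w (lshift m k) + \sum_(k < m) w (rshift n k) = \sum_i w i.
    by rewrite big_split_ord.
  rewrite ler_pdivrMl// mulr_sumr; apply: ler_sum => i _.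
  exact: adaptation_rate.
have track_le := tracking_rate L_ge0 k2_ge0 grad_lip grad_xs s mono.
have cons_le := consensus_rate L_ge0 k2_ge0 k3_ge0 grad_lip grad_xs s C_gt0 coer.
rewrite /lyapunov_rate; move: track_le cons_le fst_le snd_le W_le.
by rewrite (natrD _ n m) (mulrDl n%:R m%:R (epsilon c)); lra.
Qed.

Local Notation mu := (k2 c * mconst / 8).
Local Notation B := (2 * (N%:R ^+ 2 * k2 c * L)).
Local Notation D := (B ^+ 2 / (4 * mu)).
Local Notation K34 := (N%:R ^+ 2 * k2 c * L * (k3 c * (2 * N%:R + 1))).

(** As nu, k2 and L are at least 1, nu^2 k2 L dominates every coefficient that is
    free of k3, and no product of norms occurs with more than two of them; hence
    the factor 2 in the gain B of the cross terms. *)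
Lemma lyapunov_rate_decay : 0 < mconst -> 1 <= L -> 1 <= k2 c -> (0 < N)%N ->
  3 * B + D + 4 * mu <= k1 c -> C * (D + 3 * B + 1 + 4 * mu) <= k3 c ->
  D + 2 * B + K34 ^+ 2 + 4 * mu <= k4 c ->
  lyapunov_rate s d <=
    - (4 * mu * (x ^+ 2 + y ^+ 2 + f ^+ 2 + g ^+ 2)) + N%:R * epsilon c.
Proof.
move=> m0 L1 k21 N0 hk1 hk3 hk4; apply: le_trans lyapunov_rate_le _.
have k20 : 0 < k2 c by apply: lt_le_trans k21.
have mu0 : 0 < mu by rewrite divr_gt0 ?mulr_gt0.
have N1 : 1 <= N%:R :> R by rewrite ler1n.
have nN : n%:R <= N%:R :> R by rewrite ler_nat leq_addr.
have mN : m%:R <= N%:R :> R by rewrite ler_nat leq_addl.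
have x0 : 0 <= x := enorm_ge0 _; have y0 : 0 <= y := enorm_ge0 _.
have f0 : 0 <= f := enorm_ge0 _; have g0 : 0 <= g := enorm_ge0 _.
have n0 : 0 <= n%:R :> R by []; have m00 : 0 <= m%:R :> R by [].
move: (n%:R) (m%:R) (N%:R) x y f g n0 m00 N1 nN mN x0 y0 f0 g0 hk1 hk3 hk4.
move=> p q nu x y f g p0 q0 nu1 pnu qnu x0 y0 f0 g0 hk1 hk3 hk4.
have nu0 : 0 <= nu by apply: le_trans nu1.
set K := nu ^+ 2 * k2 c * L in hk1 hk3 hk4.
have kL1 : 1 <= k2 c * L by rewrite mulr_ege1.
have nuS : nu <= nu ^+ 2 by rewrite expr2 ler_peMl.
have nu_kL a : 0 <= a -> a <= nu -> a * (k2 c * L) <= K.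
  move=> a0 anu; rewrite /K -mulrA ler_wpM2r ?(le_trans _ kL1)//.
  exact: le_trans nuS.
have nu_L a : 0 <= a -> a <= nu -> a * L <= K.
  move=> a0 anu; apply: le_trans (nu_kL a a0 anu); rewrite ler_wpM2l//.
  by rewrite ler_peMl.
have K_nu2 : nu ^+ 2 <= K by rewrite /K -mulrA ler_peMr ?sqr_ge0.
have K1 : 1 <= K by apply: le_trans K_nu2; rewrite (le_trans nu1).
have K0 : 0 <= K by apply: le_trans K1.
have le_coef a b : a <= K -> 0 <= b -> a * b <= K * b.
  by move=> aK b0; rewrite ler_wpM2r.
have := cross_terms_le x y f g (nu ^+ 2 * k2 c * L * (k3 c * (2 * nu + 1))) mu0
  (mulr_ge0 (ler0n _ 2) K0).
rewrite -/K; set K' := K * (k3 c * _).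
set E := (2 * K) ^+ 2 / _ in hk1 hk3 hk4 *.
have xy0 : 0 <= x * y by rewrite mulr_ge0.
have fy0 : 0 <= f * y by rewrite mulr_ge0.
have fx0 : 0 <= f * x by rewrite mulr_ge0.
have gf0 : 0 <= f * g by rewrite mulr_ge0.
have yg0 : 0 <= y * g by rewrite mulr_ge0.
have ff0 : 0 <= f * f by rewrite mulr_ge0.
have yy0 : 0 <= y * y by rewrite mulr_ge0.
have xg0 : 0 <= x * g by rewrite mulr_ge0.
have c_xy := le_coef _ _ (nu_kL nu nu0 (lexx _)) xy0.
have c_xg := le_coef _ _ K1 xg0.
have c_yg := le_coef _ _ K_nu2 yg0.
have c_ff := le_coef _ _ (nu_L p p0 pnu) ff0.
have c_fy := le_coef _ _ (nu_L p p0 pnu) fy0.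
have c_fx := le_coef _ _ (nu_kL p p0 pnu) fx0.
have c_fy' := le_coef _ _ (nu_kL p p0 pnu) fy0.
have c_gf := le_coef _ _ (nu_L q q0 qnu) gf0.
have c_gy := le_coef _ _ (nu_L q q0 qnu) yg0.
have c_K' : q * nu * (k2 c * L * (k3 c * (2 * nu + 1))) * (g * y) <= K' * (g * y).
  rewrite ler_wpM2r ?(mulr_ge0 g0 y0)// /K' /K !mulrA -!mulrA.
  rewrite [leRHS](_ : _ = nu * nu * (k2 c * L * (k3 c * (2 * nu + 1)))); last by ring.
  rewrite [leLHS](_ : _ = q * nu * (k2 c * L * (k3 c * (2 * nu + 1)))); last by ring.
  by rewrite ler_wpM2r ?ler_wpM2r// !mulr_ge0// addr_ge0// mulr_ge0.
have Kyy0 : 0 <= K * (y * y) by rewrite mulr_ge0.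
have Kxg0 : 0 <= K * (x * g) by rewrite mulr_ge0.
have Kff0 : 0 <= K * (f * f) by rewrite mulr_ge0.
have Kfx0 : 0 <= K * (f * x) by rewrite mulr_ge0.
have Kfg0 : 0 <= K * (f * g) by rewrite mulr_ge0.
have d_y : (E + 3 * (2 * K) + 1 + 4 * mu) * y ^+ 2 <= k3 c / C * y ^+ 2.
  by rewrite ler_wpM2r ?sqr_ge0// ler_pdivlMr// mulrC.
have d_f : (3 * (2 * K) + E + 4 * mu) * f ^+ 2 <= k1 c * f ^+ 2.
  by rewrite ler_wpM2r ?sqr_ge0.
have d_g : (E + 2 * (2 * K) + K' ^+ 2 + 4 * mu) * g ^+ 2 <= k4 c * g ^+ 2.
  by rewrite ler_wpM2r ?sqr_ge0.
have mux : 0 <= mu * x ^+ 2 by rewrite mulr_ge0 ?sqr_ge0// ltW.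
have -> : nu ^+ 2 * (y * (k2 c * (L * (x + y)) + g)) =
    K * (x * y) + K * (y * y) + nu ^+ 2 * (y * g) by rewrite /K; ring.
clearbody K K' E; lra.
Qed.

(** When V > K0, the state errors account for at least three quarters of K0, as
    the weights stay in the ball; of the decay 6 mu K0 that they give, N epsilon
    consumes at most 2 mu K0. *)
Lemma lyapunov_rate_outside K0 : 0 < mconst -> 1 <= L -> 1 <= k2 c -> (0 < N)%N ->
  3 * B + D + 4 * mu <= k1 c -> C * (D + 3 * B + 1 + 4 * mu) <= k3 c ->
  D + 2 * B + K34 ^+ 2 + 4 * mu <= k4 c ->
  8 * N%:R * Wmax c <= beta c * K0 -> N%:R * epsilon c <= 2 * mu * K0 ->
  K0 < lyapunov s -> lyapunov_rate s d <= - (4 * mu * K0).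
Proof.
move=> m0 L1 k21 N0 hk1 hk3 hk4 hbeta heps; rewrite lyapunovE => out.
apply: le_trans (lyapunov_rate_decay m0 L1 k21 N0 hk1 hk3 hk4) _.
have mu0 : 0 < mu by rewrite divr_gt0 ?mulr_gt0// (lt_le_trans ltr01).
move: out; set Q := _ + _ + _ + _; set om := \sum_i _ => out.
have om_le : om / (2 * beta c) <= K0 / 4.
  rewrite ler_pdivrMr ?mulr_gt0//.
  apply: (@le_trans _ _ (\sum_(i < N) 4 * Wmax c)).
    by apply: ler_sum => i _; exact: sqr_enormB_le.
  by rewrite sum_ord_const; move: hbeta; lra.
have : 4 * mu * (3 / 2 * K0) <= 4 * mu * Q.
  by rewrite ler_pM2l ?mulr_gt0//; move: om_le out; lra.
by move: heps; lra.
Qed.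

End Rate.

(** The actions differ from xbar by e_f. *)
Lemma action_error_le s : enorm (st_x s - xs) ^+ 2 <= 4 * lyapunov s.
Proof.
have om0 : 0 <= \sum_i dotv (st_W s i - Ws i) (st_W s i - Ws i).
  by apply: sumr_ge0 => i _; exact: dotvv_ge0.
have {om0} : 0 <= (\sum_i dotv (st_W s i - Ws i) (st_W s i - Ws i)) / (2 * beta c).
  by rewrite divr_ge0// mulr_ge0// ltW.
rewrite lyapunovE; have := enorm_triangle (xbar s) (st_x s) xs.
rewrite (enorm_st_x_xbar P c) -ler_sqr ?nnegrE ?addr_ge0 ?enorm_ge0//.
move: (enorm (lsubmx _)) (enorm (xbar s - xs)) (_ / (2 * beta c)) => f x om h om0.
have := sqr_ge0 (f - x); have := sqr_ge0 (enorm (mxvec (disagreement s))).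
have := sqr_ge0 (enorm (rsubmx (err P c s))).
by move: h; rewrite sqrrB sqrrD; lra.
Qed.

Lemma lyapunov_init s Lambda :
  init_deviation xs s + \sum_i dotv (st_W s i - Ws i) (st_W s i - Ws i) <= Lambda ->
  lyapunov s <=
    (Lambda ^+ 2 + (m%:R * (k2 c * (L * (Lambda + Lambda))) + Lambda) ^+ 2) / 2
    + Lambda / (2 * beta c).
Proof.
set om := \sum_i _; rewrite lyapunovE -/om => init.
have om0 : 0 <= om by apply: sumr_ge0 => i _; exact: dotvv_ge0.
have dev0 : 0 <= init_deviation xs s by exact: enorm_ge0.
have dev_le : init_deviation xs s <= Lambda by lra.
have Lambda0 : 0 <= Lambda by lra.
have devE : init_deviation xs s ^+ 2 = enorm (xbar s - xs) ^+ 2 + (enorm (st_v s) ^+ 2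
    + (enorm (mxvec (disagreement s)) ^+ 2 + enorm (lsubmx (err P c s)) ^+ 2)).
  by rewrite /init_deviation !sqr_enorm_row_mx /err row_mxKl.
have dev2 : init_deviation xs s ^+ 2 <= Lambda ^+ 2 by rewrite ler_sqr ?nnegrE.
rewrite devE in dev2.
have x2 := sqr_ge0 (enorm (xbar s - xs)); have v2 := sqr_ge0 (enorm (st_v s)).
have y2 := sqr_ge0 (enorm (mxvec (disagreement s))).
have f2 := sqr_ge0 (enorm (lsubmx (err P c s))).
have xLam : enorm (xbar s - xs) <= Lambda.
  by rewrite -ler_sqr ?nnegrE ?enorm_ge0//; lra.
have vLam : enorm (st_v s) <= Lambda by rewrite -ler_sqr ?nnegrE ?enorm_ge0//; lra.
have yLam : enorm (mxvec (disagreement s)) <= Lambda.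
  by rewrite -ler_sqr ?nnegrE ?enorm_ge0//; lra.
have gLam : enorm (rsubmx (err P c s)) <= m%:R * (k2 c * (L * (Lambda + Lambda))) + Lambda.
  pose gam : 'rV[R]_m := \row_k (k2 c * grad P (rshift n k) (est s (rshift n k))).
  rewrite (_ : rsubmx _ = gam + st_v s); last first.
    by apply/rowP => k; rewrite /err row_mxKr !mxE.
  apply: le_trans (ler_enormD _ _) (lerD _ vLam).
  apply: le_trans (ler_enorm_sum _) _; rewrite -sum_ord_const.
  apply: ler_sum => k _; rewrite mxE normrM (ger0_norm k2_ge0) ler_wpM2l//.
  apply: le_trans (grad_est L_ge0 grad_lip grad_xs s _) _.
  by rewrite ler_wpM2l// lerD.
have g2 : enorm (rsubmx (err P c s)) ^+ 2 <=
    (m%:R * (k2 c * (L * (Lambda + Lambda))) + Lambda) ^+ 2.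
  rewrite ler_sqr ?nnegrE ?enorm_ge0//.
  by rewrite addr_ge0// !mulr_ge0// addr_ge0.
apply: lerD; first by lra.
by rewrite ler_wpM2r ?invr_ge0 ?mulr_ge0 ?(ltW beta_gt0)//; lra.
Qed.

End Lyapunov.

(** * The Lyapunov function along a solution *)

Section Trajectory.
Context {R : realType} {n m : nat}.
Variables (P : plant R n m) (nn : network R (n + m)) (c : params R).
Local Notation N := (n + m)%N.
Variable s : R -> state nn.
Hypothesis sol : closed_loop_solution P c s.

(** |W|^2 / 2 has zero rate outside the ball: the decay lemma at rate 0. *)
Lemma weights_in_ball i t : 0 < Wmax c -> 0 <= t ->
  dotv (st_W (s t) i) (st_W (s t) i) <= Wmax c.
Proof.
move=> W0 t0.
have halfE r : \sum_l st_W (s r) i 0 l ^+ 2 / 2 = dotv (st_W (s r) i) (st_W (s r) i) / 2.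
  by rewrite -mulr_suml -enorm_sum sqr_enorm.
have subW : subcaratheodory (fun t => \sum_l st_W (s t) i 0 l ^+ 2 / 2)
    (fun t => \sum_l st_W (s t) i 0 l * weight_law P c (s t) i 0 l).
  apply: subcaratheodory_sum => l.
  exact: subcaratheodory_half_sqr0 (W_dyn sol l).
suff : dotv (st_W (s t) i) (st_W (s t) i) / 2 <= Wmax c / 2 by rewrite ler_pM2r.
rewrite -halfE -[leRHS]maxxx -{2}[Wmax c / 2]subr0 -[X in _ - X](mul0r t).
apply: (subcaratheodory_decay subW) => //.
  by rewrite halfE ler_pM2r// (W_init sol).
move=> r r0; rewrite halfE ltr_pM2r// => out.
by rewrite weight_law_outside// oppr0.
Qed.

Lemma caratheodory_xbar j :
  caratheodory (fun t => xbar (s t) 0 j) (fun t => xbar_rate P c (s t) 0 j).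
Proof.
case: (split_ordP j) => k ->.
  have -> : (fun t => xbar (s t) 0 (lshift m k)) = fun t => st_z (s t) 0 k.
    by apply/funext => t; rewrite row_mxEl.
  have -> : (fun t => xbar_rate P c (s t) 0 (lshift m k)) =
      fun t => - k2 c * grad P (lshift m k) (est (s t) (lshift m k)).
    by apply/funext => t; rewrite row_mxEl mxE.
  exact: z_dyn sol k.
have -> : (fun t => xbar (s t) 0 (rshift n k)) = fun t => st_x (s t) 0 (rshift n k).
  by apply/funext => t; rewrite row_mxEr mxE.
have -> : (fun t => xbar_rate P c (s t) 0 (rshift n k)) = fun t => st_v (s t) 0 k.
  by apply/funext => t; rewrite row_mxEr.
exact: x_snd_dyn sol k.
Qed.

(** The estimates are absolutely continuous, so a Lipschitz function of them has
    increments bounded by an integral. *)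
Lemma grad_est_increment L i a b : 0 <= L -> 0 <= k2 c -> elipschitz L (grad P i) ->
  0 <= a -> a <= b ->
  `|k2 c * grad P i (est (s b) i) - k2 c * grad P i (est (s a) i)| <=
  iint a b (fun t => grad_rate_bound P c L (s t) i).
Proof.
move=> L0 k20 lip a0 ab.
have iF j : segment_integrable (fun t => estimator_law P c (s t) i j).
  by move=> t /(y_dyn sol i j)[].
have inF j := segment_integrable_norm (iF j).
have isum : segment_integrable (fun t => \sum_j `|estimator_law P c (s t) i j|).
  exact: segment_integrable_sum.
rewrite /grad_rate_bound !iintZ//; last exact: segment_integrableZ.
rewrite -mulrBr normrM (ger0_norm k20) ler_wpM2l//.
apply: le_trans (lip _ _) _; rewrite ler_wpM2l//.
apply: le_trans (ler_enorm_sum _) _; rewrite iint_sum//; apply: ler_sum => j _.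
rewrite !mxE (caratheodory_iint (y_dyn sol i j) a0 ab).
exact: ler_norm_iint.
Qed.

Lemma lyapunov_subcaratheodory xs Ws L : 0 <= L -> 0 <= k2 c -> 0 < beta c ->
  (forall i, elipschitz L (grad P i)) ->
  subcaratheodory (fun t => lyapunov P c xs Ws (s t))
    (fun t => lyapunov_rate P c xs Ws L (s t) (fun i => disturbance P i t)).
Proof.
move=> L0 k20 beta0 lip.
apply: subcaratheodoryD; first apply: subcaratheodoryD;
  first apply: subcaratheodoryD; first apply: subcaratheodoryD.
- apply: subcaratheodory_sum => j; apply: subcaratheodory_half_sqr0.
  have := caratheodoryB (caratheodory_xbar j) (caratheodory_cst (xs 0 j)).
  rewrite (_ : (fun t => xbar (s t) 0 j - xs 0 j) = fun t => (xbar (s t) - xs) 0 j).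
    by under [X in caratheodory _ X]eq_fun do rewrite subr0.
  by apply/funext => t; rewrite [RHS]mxE [X in _ = _ + X]mxE.
- apply: subcaratheodory_sum => i; apply: subcaratheodory_sum => j.
  apply: subcaratheodory_half_sqr0.
  have := caratheodoryB (y_dyn sol i j) (caratheodory_xbar j).
  rewrite (_ : (fun t => st_y (s t) i j - xbar (s t) 0 j) =
    fun t => disagreement (s t) i j)//.
  by apply/funext => t; rewrite [RHS]mxE.
- apply: subcaratheodory_sum => k; apply: subcaratheodory_half_sqr0.
  have := caratheodoryB (x_fst_dyn sol k) (z_dyn sol k).
  rewrite (_ : (fun t => st_x (s t) 0 (lshift m k) - st_z (s t) 0 k) =
    fun t => err P c (s t) 0 (lshift m k))//.
  by apply/funext => t; rewrite /err row_mxEl !mxE.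
- apply: subcaratheodory_sum => k; pose i := rshift n k.
  have errE : (fun t => err P c (s t) 0 i) =
      (fun t => k2 c * grad P i (est (s t) i) + st_v (s t) 0 k).
    by apply/funext => t; rewrite /err row_mxEr mxE.
  have := @subcaratheodory_half_sqr _ (fun t => k2 c * grad P i (est (s t) i)) _ _
    (fun t => grad_rate_bound P c L (s t) i) (v_dyn sol k).
  under [X in subcaratheodory X _]eq_fun do rewrite -/i.
  have eE t : k2 c * grad P i (est (s t) i) + st_v (s t) 0 k = err P c (s t) 0 i.
    by have := congr1 (@^~ t) errE.
  under [X in subcaratheodory X _]eq_fun do rewrite eE.
  under [X in subcaratheodory _ X]eq_fun do rewrite eE.
  apply.
  + apply: segment_integrableZ; apply: segment_integrableZ.
    apply: segment_integrable_sum => j; apply: segment_integrable_norm.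
    by move=> t /(y_dyn sol i j)[].
  + by move=> t; rewrite !mulr_ge0// sumr_ge0.
  + by move=> a b a0 ab; exact: grad_est_increment.
- apply: subcaratheodoryZ; first by rewrite invr_ge0 ltW.
  apply: subcaratheodory_sum => i; apply: subcaratheodory_sum => l.
  apply: subcaratheodory_half_sqr0.
  have := caratheodoryB (W_dyn sol l) (caratheodory_cst (Ws i 0 l)).
  rewrite (_ : (fun t => st_W (s t) i 0 l - Ws i 0 l) =
    fun t => (st_W (s t) i - Ws i) 0 l).
    by under [X in caratheodory _ X]eq_fun do rewrite subr0.
  by apply/funext => t; rewrite !mxE.
Qed.

End Trajectory.

(** * Ultimate boundedness *)

Lemma elipschitz_le (R : realType) p (l l' : R) (h : 'rV[R]_p -> R) :
  l <= l' -> elipschitz l h -> elipschitz l' h.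
Proof.
by move=> ll' lip u v; apply: le_trans (lip u v) _; rewrite ler_wpM2r ?enorm_ge0.
Qed.

Theorem theorem1 (R : realType) (n m : nat) (P : plant R n m)
    (nn : network R (n + m)) (Wmax delta epsilon kappa : R)
    (lbar eta : 'I_(n + m) -> R) (mconst : R) (xs : 'rV[R]_(n + m))
    (n_gt0 : (0 < n)%N) (m_gt0 : (0 < m)%N)
    (Wmax_gt0 : 0 < Wmax) (delta_gt0 : 0 < delta) (epsilon_gt0 : 0 < epsilon)
    (kappa_def : kappa = expR (- (kappa + 1)))
    (width_gt0 : forall i (l : 'I_(nn_size nn i)), 0 < width l)
    (xs_nash : nash_equilibrium P xs)
    (A1 : forall i, C2 (cost P i) /\ elipschitz (lbar i) (grad P i))
    (A2 : undirected_connected P)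
    (A3_gt0 : 0 < mconst)
    (A3 : forall x z : 'rV[R]_(n + m),
      mconst * enorm (x - z) ^+ 2 <=
        dotv (x - z) (pseudo_gradient P x - pseudo_gradient P z))
    (A4 : forall (k : 'I_m) (j : 'I_(n + m)),
      exists B : R, forall x, `|hess P (rshift n k) j x| <= B)
    (A5 : forall i, elipschitz (eta i) (drift P i) /\
      exists B : R, forall t, 0 <= t -> `|disturbance P i t| <= B) :
  forall Lambda Xi : R, 0 < Lambda -> 0 < Xi ->
  exists (beta_s k2_s : R) (k1_s k3_s : R -> R) (k4_s : R -> R -> R),
    0 < beta_s /\ 0 < k2_s /\
    forall beta k2 : R, beta_s < beta -> k2_s < k2 ->
    0 < k1_s k2 /\ 0 < k3_s k2 /\
    forall k1 k3 : R, k1_s k2 < k1 -> k3_s k2 < k3 ->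
    0 < k4_s k2 k3 /\
    forall k4 : R, k4_s k2 k3 < k4 ->
    exists T : R, 0 <= T /\
    forall (s : R -> state nn)
      (Ws : forall i : 'I_(n + m), 'rV[R]_(nn_size nn i))
      (eps : 'I_(n + m) -> 'rV[R]_(n + m) -> R) (epsbar : R),
      closed_loop_solution P
        (Params k1 k2 k3 k4 beta Wmax delta epsilon kappa) s ->
      0 < epsbar ->
      (forall i, approximates P s (Ws i) (eps i) epsbar) ->
      (forall i t, 0 <= t ->
        `|eps i (est (s t) i)| + `|disturbance P i t| <= delta) ->
      (forall i, dotv (Ws i) (Ws i) <= Wmax) ->
      init_deviation xs (s 0)
        + \sum_i dotv (st_W (s 0) i - Ws i) (st_W (s 0) i - Ws i) <= Lambda ->
      forall t, T < t -> enorm (st_x (s t) - xs) <= Xi.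
Proof.
move=> Lambda Xi Lambda_gt0 Xi_gt0.
have [_ edge_sym edge_conn] := A2.
have N_gt1 : (1 < n + m)%N by rewrite (leq_add n_gt0 m_gt0).
have N_gt0 := ltnW N_gt1.
have [C C_gt0 coer] := @pinned_form_coercive R _ _ edge_sym edge_conn N_gt1.
pose L := 1 + \sum_i `|lbar i| + \sum_i `|eta i|.
have sum_ge0 (h : 'I_(n + m) -> R) : 0 <= \sum_i `|h i| by apply: sumr_ge0.
have le_sum (h : 'I_(n + m) -> R) i : h i <= \sum_i `|h i|.
  apply: le_trans (ler_norm _) _; rewrite (bigD1 i)//= lerDl.
  by apply: sumr_ge0.
have L_ge1 : 1 <= L by rewrite /L -addrA lerDl addr_ge0.
have L_ge0 : 0 <= L by apply: le_trans L_ge1.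
have grad_lip i : elipschitz L (grad P i).
  apply: elipschitz_le (A1 i).2.
  by have := le_sum lbar i; have := sum_ge0 eta; rewrite /L; lra.
have drift_lip i : elipschitz L (drift P i).
  apply: elipschitz_le (A5 i).1.
  by have := le_sum eta i; have := sum_ge0 lbar; rewrite /L; lra.
have grad_xs i : grad P i xs = 0.
  by apply: nash_grad_eq0 xs_nash _; have [[[_ /(_ i)[]]]] := A1 i.
pose nu : R := (n + m)%:R.
have nu_gt0 : 0 < nu by rewrite ltr0n.
(* |x - xs| <= Xi as soon as V <= K0. *)
pose K0 := Xi ^+ 2 / 4.
have K0_gt0 : 0 < K0 by rewrite divr_gt0// exprn_gt0.
pose mu k2 := k2 * mconst / 8.
pose B k2 := 2 * (nu ^+ 2 * k2 * L).
pose D k2 := B k2 ^+ 2 / (4 * mu k2).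
pose K34 k2 k3 := nu ^+ 2 * k2 * L * (k3 * (2 * nu + 1)).
have mu_gt0 k2 : 0 < k2 -> 0 < mu k2 by move=> ?; rewrite divr_gt0 ?mulr_gt0.
have B_ge0 k2 : 0 < k2 -> 0 <= B k2.
  by move=> k20; rewrite !mulr_ge0 ?sqr_ge0// ltW.
have D_ge0 k2 : 0 < k2 -> 0 <= D k2.
  by move=> k20; rewrite divr_ge0 ?sqr_ge0// mulr_ge0// ltW// mu_gt0.
exists (8 * nu * Wmax / K0), (1 + 4 * nu * epsilon / (mconst * K0)).
exists (fun k2 => 3 * B k2 + D k2 + 4 * mu k2).
exists (fun k2 => C * (D k2 + 3 * B k2 + 1 + 4 * mu k2)).
exists (fun k2 k3 => D k2 + 2 * B k2 + K34 k2 k3 ^+ 2 + 4 * mu k2).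
split; first by rewrite divr_gt0// !mulr_gt0.
split; first by rewrite addr_gt0// divr_gt0// !mulr_gt0.
move=> beta k2 hbeta hk2.
have beta_gt0 : 0 < beta by apply: le_lt_trans hbeta; rewrite divr_ge0// ?mulr_ge0// ltW.
have k2_gt1 : 1 < k2.
  by apply: le_lt_trans hk2; rewrite lerDl divr_ge0// ?mulr_ge0// ltW.
have k2_gt0 : 0 < k2 by apply: lt_trans k2_gt1.
have := mu_gt0 k2 k2_gt0; have := B_ge0 k2 k2_gt0; have := D_ge0 k2 k2_gt0.
move=> Dk2 Bk2 muk2.
have k3s_gt0 : 0 < C * (D k2 + 3 * B k2 + 1 + 4 * mu k2).
  by rewrite mulr_gt0//; lra.
split; first by lra.
split=> // k1 k3 hk1 hk3; have k3_gt0 := lt_trans k3s_gt0 hk3.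
split; first by have := sqr_ge0 (K34 k2 k3); lra.
move=> k4 hk4.
(* M bounds V at time 0, and V decreases at rate 4 mu K0 until it reaches K0. *)
pose M := (Lambda ^+ 2 + (m%:R * (k2 * (L * (Lambda + Lambda))) + Lambda) ^+ 2) / 2
    + Lambda / (2 * beta).
have rate_gt0 : 0 < 4 * mu k2 * K0 by rewrite !mulr_gt0.
have M_ge0 : 0 <= M.
  rewrite addr_ge0// divr_ge0// ?addr_ge0 ?sqr_ge0//; first exact: ltW.
  by rewrite mulr_ge0// ltW.
exists (M / (4 * mu k2 * K0)); split; first by rewrite divr_ge0// ltW.
move=> s Ws eps epsbar sol _ approx robust Ws_ball init t Tt.
have t_ge0 : 0 <= t.
  by rewrite (le_trans _ (ltW Tt))// divr_ge0// ltW.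
set c := Params _ _ _ _ _ _ _ _ _ in sol.
have subV := @lyapunov_subcaratheodory _ _ _ _ _ c s sol xs Ws L L_ge0
  (ltW k2_gt0) beta_gt0 grad_lip.
have V0 : lyapunov P c xs Ws (s 0) <= M.
  exact: (@lyapunov_init _ _ _ P nn c xs Ws L L_ge0 (ltW k2_gt0) beta_gt0
    grad_lip grad_xs (s 0) Lambda init).
have decay r : 0 <= r -> K0 < lyapunov P c xs Ws (s r) ->
    lyapunov_rate P c xs Ws L (s r) (fun i => disturbance P i r) <= - (4 * mu k2 * K0).
  move=> r0.
  apply: (@lyapunov_rate_outside _ _ _ P nn c xs Ws L L_ge0 (ltW k2_gt0) (ltW k3_gt0)
    (ltW delta_gt0) epsilon_gt0 kappa_def beta_gt0 Wmax_gt0 grad_lip drift_lip grad_xs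
    Ws_ball mconst C A3 C_gt0 coer (s r) (fun i => eps i (est (s r) i))) => //.
  - move=> i; have [Om [_ est_in /(_ _ (est_in r r0))[]]] := approx i.
    by move=> ->.
  - by move=> i; exact: robust.
  - by move=> i; exact: (weights_in_ball sol).
  - exact: ltW.
  - exact: ltW.
  - exact: ltW.
  - exact: ltW.
  - by move: hbeta; rewrite ltr_pdivrMr// => /ltW.
  - have : 4 * nu * epsilon / (mconst * K0) <= k2 by lra.
    by rewrite ler_pdivrMr ?mulr_gt0// /mu/= -/nu; lra.
have := subcaratheodory_decay subV (ltW rate_gt0) V0 decay t_ge0.
have late : M - 4 * mu k2 * K0 * t <= K0.
  by move: Tt; rewrite ltr_pdivrMr//; lra.
rewrite (max_idPl late) => VK0.
rewrite -ler_sqr ?nnegrE ?enorm_ge0 ?(ltW Xi_gt0)//.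
have := @action_error_le _ _ _ P nn c xs Ws beta_gt0 (s t).
by move: VK0; rewrite /K0; lra.
Qed.
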